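(* Let $g:(0,1]\to\mathbb{R}$, $g(x)=1/x$, let $S_ng(x)=g(x)+g(Tx)+\cdots+g(T^{n-1}x)$ be its Birkhoff sums under the doubling map $T$, and for a function $\Psi$ of $n$ and $\beta\in[0,\infty]$ let $F_\Psi(\beta)=\{x\in(0,1]:\lim_{n\to\infty}S_ng(x)/\Psi(n)=\beta\}$. (1) If $\Psi(n)=n\log n$, or $\Psi(n)=n^a$ for some $a>1$, or $\Psi(n)=2^{n^\gamma}$ for some $0<\gamma<1/2$, then $\dim_H F_\Psi(\beta)=1$ for every $\beta\in[0,\infty]$. (2) If $\Psi(n)=2^{n^\gamma}$ with $1/2\le\gamma<1$, then $F_\Psi(\beta)$ is empty for every $\beta\in(0,\infty)$, and $\dim_H F_\Psi(\beta)=1$ for $\beta=0$ and for $\beta=+\infty$. (3) If $\Psi(n)=2^{n^\gamma}$ with $\gamma\ge1$, then $F_\Psi(\beta)$ is empty for every $\beta\in(0,\infty]$, and $\dim_H F_\Psi(0)=1$.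
   Context: $T:(0,1]\to(0,1]$ is the doubling map $Tx=2x-\lceil 2x\rceil+1$, where $\lceil y\rceil$ is the smallest integer $\ge y$. For $\beta=+\infty$ the limit defining $F_\Psi(\beta)$ means divergence to $+\infty$. $\dim_H$ denotes Hausdorff dimension. *)

(* Defs.v *)
From HB Require Import structures.
From mathcomp Require Import all_boot all_order all_algebra.
From mathcomp Require Import all_classical all_reals all_analysis.
Set Implicit Arguments.
Unset Strict Implicit.
Unset Printing Implicit Defensive.
Import Order.TTheory GRing.Theory Num.Theory.
Import numFieldNormedType.Exports.

Local Open Scope classical_set_scope.
Local Open Scope ring_scope.

(* The supremum over the empty set is -oo, so diam set0 = -oo. *)
Definition diam (R : realType) (U : set R) : \bar R :=
  ereal_sup [set (`|x - y|)%:E | x in U & y in U].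

(* |U|^s with |set0|^s = 0 and, for U nonempty, |U|^0 = 1 (also when |U| = 0),
   so that the 0-dimensional measure is the counting measure. *)
Definition diam_pow (R : realType) (s : R) (U : set R) : \bar R :=
  if U == set0 then 0%E else (diam U `^ s)%E.

(* Finite covers are included: pad with set0. *)
Definition delta_cover (R : realType) (delta : R) (E : set R) :
    set (nat -> set R) :=
  [set U | E `<=` \bigcup_k U k /\ forall k, (diam (U k) <= delta%:E)%E].

Definition hausdorff_premeasure (R : realType) (s delta : R) (E : set R) :
    \bar R :=
  ereal_inf
    [set (\sum_(0 <= k <oo) diam_pow s (U k))%E | U in delta_cover delta E].

(* The limit as delta tends to 0+, i.e., the supremum over delta > 0. *)
Definition hausdorff_measure (R : realType) (s : R) (E : set R) : \bar R :=
  ereal_sup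
    [set hausdorff_premeasure s delta E | delta in [set d : R | 0 < d]].

Definition hausdorff_dim (R : realType) (E : set R) : \bar R :=
  ereal_inf
    [set s%:E | s in [set s : R | 0 <= s /\ hausdorff_measure s E = 0%E]].

(* Only used on ]0, 1], which it maps to itself (doublingP). *)
Definition doubling (R : realType) (x : R) : R :=
  2 * x - (Num.ceil (2 * x))%:~R + 1.

Lemma doublingP (R : realType) (x : R) : 0 < doubling x <= 1.
Proof.
have := ceil_itv (2 * x); rewrite /doubling => /andP[h1 h2].
rewrite -lerBrDr subrr subr_le0 h2 andbT.
by move: h1; rewrite intrB mulr1z ltrBlDr -subr_gt0 addrAC.
Qed.

Definition birkhoff_sum (X : Type) (V : nmodType) (T : X -> X) (g : X -> V)
    (n : nat) (x : X) : V :=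
  \sum_(i < n) g (iter i T x).

(* The limit is taken in \bar R, so that beta = +oo means divergence to +oo.
   The finitely many n with Psi n = 0 (e.g. n = 0, 1 for n log n) do not matter. *)
Definition level_set (R : realType) (Psi : nat -> R) (beta : \bar R) : set R :=
  [set x : R | 0 < x <= 1 /\
    (birkhoff_sum (@doubling R) (fun y => y^-1) n x / Psi n)%:E
      @[n --> \oo] --> beta].

(* Main.v *)
(** Write x in binary as x = sum of e_i 2^-(i+1): the doubling map shifts the
    digits, and 1/T^i x is about 2^l when l zeros follow position i.

    Points of a level set.  Prescribe the digits on a set of positions of small
    density and copy the binary digits of a parameter t in ]0, 1] to the other
    positions.  If every window of length N contains a prescribed position, the
    inverse of this coding is s-Hoelder for every s below the lower density of the
    free positions, so sets that contain such points for every s < 1 have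
    dimension 1.  The prescribed digits are a 1 at the multiples of N, together
    with words 1 0^k 1^(k+1) at sparse positions b_j.  Outside the words
    1/T^i x <= 2^N, while a word adds 2^(k+1) - 2 to the Birkhoff sum up to a
    bounded error per position; the ones behind the zeros are what makes this
    value precise.  Hence S_n x = W_n + O(n) with a deterministic W_n.
    - beta = 0: no zeros at all, as n = o(Psi(n)).
    - beta = +oo: b_j = 2^(j+1) and a run of about 2 (b_{j+2})^gamma zeros.
    - 0 < beta < +oo: b_j = (j+1)^2, whose gaps of order j leave room for runs of
      length O(j^(2 gamma)) with gamma < 1/2; each run is the longest one that keeps
      W below beta Psi.  This at least halves the defect beta Psi - W, up to the
      increment of Psi, which is o(Psi(j^2)) from one square to the next.

    Empty level sets.  If gamma < 1 and S_n x ~ beta Psi(n), every single term is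
    o(Psi(n)), and a term above 2^L is followed by L halvings.  Between (2L)^2 and
    (2L+1)^2 there is room for boundedly many such descents, so the sum grows by
    o(Psi), although Psi doubles since gamma >= 1/2.  If gamma >= 1, consider the
    infinitely many p with T^p x > 1/2: there the next term is less than 2 whereas
    Psi doubles, and S_p x <= 2^(p+2). *)

Require Import Defs.
From HB Require Import structures.
From mathcomp Require Import all_boot all_order all_algebra.
From mathcomp Require Import all_classical all_reals all_analysis.
From mathcomp Require Import lra zify.
Set Implicit Arguments.
Unset Strict Implicit.
Unset Printing Implicit Defensive.
Import Order.TTheory GRing.Theory Num.Theory.
Import numFieldNormedType.Exports.

Local Open Scope classical_set_scope.
Local Open Scope ring_scope.

(** * Hausdorff dimension of subsets of the unit interval *)

Section hausdorff_unit_interval.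
Context {R : realType}.
Implicit Types (E U : set R) (s delta : R).

Lemma diam_pow_ge0 s U : (0 <= diam_pow s U)%E.
Proof. by rewrite /diam_pow; case: ifP => // _; exact: poweR_ge0. Qed.

Lemma diam_ge U x y : U x -> U y -> (`|x - y|%:E <= diam U)%E.
Proof. by move=> Ux Uy; apply: ereal_sup_ubound; exists x => //; exists y. Qed.

Lemma hausdorff_premeasure_ge0 s delta E :
  (0 <= hausdorff_premeasure s delta E)%E.
Proof.
apply: le_ereal_inf_tmp => _ [U _ <-]; apply: nneseries_ge0 => k _ _.
exact: diam_pow_ge0.
Qed.

(** Cover by [n.+1] closed intervals of length 1/(n+1), padded with empty sets; each interval
    contributes at most its length to the power [s]. *)
Lemma hausdorff_premeasure_unit s delta (n : nat) E :
  E `<=` `]0, 1]%classic -> 0 <= s -> n.+1%:R^-1 <= delta ->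
  (hausdorff_premeasure s delta E <= (n.+1%:R * n.+1%:R^-1 `^ s)%:E)%E.
Proof.
move=> E01 s0 ndelta.
pose h : R := n.+1%:R^-1.
have h0 : 0 < h by rewrite invr_gt0.
pose U k : set R := if (k <= n)%N then `[k%:R * h, k.+1%:R * h]%classic else set0.
have diamU k : (diam (U k) <= h%:E)%E.
  apply: ge_ereal_sup => _ [x Ux [y Uy <-]]; move: Ux Uy; rewrite /U lee_fin.
  case: leqP => // _; rewrite /= !in_itv/= -natr1 mulrDl mul1r => /andP[? ?] /andP[? ?].
  by rewrite ler_norml; lra.
apply: (@le_trans _ _ (\sum_(0 <= k <oo) diam_pow s (U k))%E).
  apply: ereal_inf_lbound; exists U => //; split; last first.
    by move=> k; rewrite (le_trans (diamU k))// lee_fin.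
  move=> x /E01; rewrite /= in_itv/= => /andP[x0 x1].
  have [k_le_x x_lt_k] := andP (@truncn_itv _ (x * n.+1%:R) (mulr_ge0 (ltW x0)
    (ler0n _ _))).
  have [tn|tn] := leqP (Num.truncn (x * n.+1%:R)) n.
    exists (Num.truncn (x * n.+1%:R)) => //; rewrite /U tn /= in_itv/=.
    by rewrite ler_pdivrMr// k_le_x ler_pdivlMr// ltW.
  (* The truncation exceeds [n] only at the right endpoint, which the last closed interval
     contains. *)
  have -> : x = 1.
    apply/eqP; rewrite eq_le x1 /=.
    have : n.+1%:R <= x * n.+1%:R by rewrite (le_trans _ k_le_x)// ler_nat.
    by rewrite ler_pMl// ltr0n.
  exists n => //; rewrite /U leqnn /= in_itv/= divff ?pnatr_eq0// lexx andbT.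
  by rewrite ler_pdivrMr// mul1r ler_nat.
rewrite (nneseries_split 0 n.+1); last by move=> *; exact: diam_pow_ge0.
rewrite add0n [X in (_ + X)%E]eseries0 ?adde0; last first.
  by move=> i ni _; rewrite /diam_pow /U leqNgt ni/= eqxx.
rewrite big_mkord.
apply: (@le_trans _ _ (\sum_(i < n.+1) (h `^ s)%:E)%E); last first.
  by rewrite sumEFin lee_fin sumr_const card_ord mulr_natl.
apply: lee_sum => i _; rewrite /diam_pow; case: ifPn => [_|Ui].
  by rewrite lee_fin powR_ge0.
have d0 : (0 <= diam (U i))%E.
  by move/set0P: Ui => [x Ux]; apply: le_trans (diam_ge Ux Ux); rewrite lee_fin.
rewrite -poweR_EFin; apply: gt0_ler_poweR => //; rewrite ?in_itv ?inE /= ?leey ?andbT//.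
by rewrite lee_fin ltW.
Qed.

Lemma hausdorff_measure_unit_eq0 s E :
  E `<=` `]0, 1]%classic -> 1 < s -> hausdorff_measure s E = 0%E.
Proof.
move=> E01 s1; apply/eqP; rewrite eq_le; apply/andP; split; last first.
  apply: (@le_trans _ _ (hausdorff_premeasure s 1 E)).
    exact: hausdorff_premeasure_ge0.
  by apply: ereal_sup_ubound; exists 1 => //=; rewrite ltr01.
apply: ge_ereal_sup => _ [delta /= delta0 <-].
apply/lee_addgt0Pr => e e0; rewrite add0e.
(* The first summand makes 1/(n+1) at most [delta], the second makes (n+1)^(1-s) at most [e]. *)
pose A := delta^-1 + e^-1 `^ (s - 1)^-1.
have A0 : 0 < A by rewrite ltr_wpDr ?powR_ge0 ?invr_gt0.
have An : A < (Num.truncn A).+1%:R by exact: truncnS_gt.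
set n := Num.truncn A in An.
have s10 : 0 < s - 1 by rewrite subr_gt0.
have ne : e^-1 <= n.+1%:R `^ (s - 1).
  have -> : e^-1 = (e^-1 `^ (s - 1)^-1) `^ (s - 1).
    by rewrite -powRrM mulVf ?gt_eqF// powRr1// invr_ge0 ltW.
  apply: ge0_ler_powR; rewrite ?nnegrE ?powR_ge0 ?ler0n ?(ltW s10)//.
  by rewrite (le_trans _ (ltW An))// ler_wpDl// invr_ge0 ltW.
have ndelta : n.+1%:R^-1 <= delta.
  rewrite invf_ple ?posrE ?ltr0n// (le_trans _ (ltW An))//.
  by rewrite ler_wpDr// powR_ge0.
have s0 : 0 <= s by lra.
apply: (le_trans (hausdorff_premeasure_unit E01 s0 ndelta)).
have -> : n.+1%:R * n.+1%:R^-1 `^ s = (n.+1%:R `^ (s - 1))^-1 :> R.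
  rewrite -powR_inv1 ?ler0n// -powRrM mulN1r -powRN opprB.
  by rewrite -{1}(@powRr1 _ n.+1%:R)// -powRD// pnatr_eq0 implybT.
by rewrite lee_fin invf_ple ?posrE// powR_gt0 ltr0n.
Qed.

Lemma hausdorff_dim_le1 E : E `<=` `]0, 1]%classic -> (hausdorff_dim E <= 1)%E.
Proof.
move=> E01; apply/lee_addgt0Pr => e e0; apply: ereal_inf_lbound.
exists (1 + e) => //; split; first by lra.
by apply: hausdorff_measure_unit_eq0 => //; rewrite ltrDl.
Qed.

(* If s < 1 and H^s E = 0, then the preimages under sigma of an economical
   cover of E cover ]0, 1] and have small total length. *)
Lemma hausdorff_measure_expanding_neq0 s E (C : R) (sigma : R -> R) :
  0 < C ->
  (forall t, 0 < t <= 1 -> E (sigma t)) ->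
  (forall t u, 0 < t <= 1 -> 0 < u <= 1 ->
     `|t - u| <= C * `|sigma t - sigma u| `^ s) ->
  0 <= s -> hausdorff_measure s E <> 0%E.
Proof.
move=> C0 sE sC s0 HE.
(* The intervals built below have length at most 2C times the corresponding power of a diameter, so
   this bound leaves total length at most 1/2. *)
have : (hausdorff_premeasure s 1 E < (C *+ 4)^-1%:E)%E.
  apply: (@le_lt_trans _ _ 0%E); last first.
    by rewrite lte_fin invr_gt0 pmulrn_lgt0.
  by rewrite -HE; apply: ereal_sup_ubound; exists 1 => //=; rewrite ltr01.
move=> /ereal_inf_lt[_ [U [EU dU] <-] sumU].
pose V k := sigma @^-1` U k `&` `]0, 1]%classic.
(* Preimages under [sigma] need not be measurable: each nonempty one is enclosed in a closed
   interval centred at one of its points. *)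
pose I k : set R := if pselect (exists t, V k t) is left Vk then
    let t := projT1 (cid Vk) in
    let d := C * fine (diam (U k)) `^ s in `[t - d, t + d]%classic
  else set0.
have diamfin k x : U k x -> (0 <= fine (diam (U k)))%R /\
    ((fine (diam (U k)))%:E = diam (U k)).
  move=> Ux; have d0 : (0 <= diam (U k))%E.
    by apply: le_trans (diam_ge Ux Ux); rewrite lee_fin.
  split; first exact: fine_ge0.
  apply: fineK; apply/fin_numPlt; rewrite (lt_le_trans _ d0)//=.
  by apply: le_lt_trans (dU k) _; rewrite ltry.
have VI k : V k `<=` I k.
  move=> t Vt; rewrite /I; case: pselect => [p|[]]; last by exists t.
  case: (cid p) => /= u [Uu /= u01]; case: Vt => /= Ut t01.
  rewrite in_itv/= in t01; rewrite in_itv/= in u01.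
  have [d0 dE] := diamfin _ _ Uu.
  have tu : `|t - u| <= C * fine (diam (U k)) `^ s.
    apply: (le_trans (sC _ _ t01 u01)).
    rewrite ler_pM2l// ge0_ler_powR// ?nnegrE//.
    by rewrite -lee_fin dE; exact: diam_ge.
  by move: tu; rewrite in_itv/= ler_norml => ?; lra.
have mI k : measurable (I k).
  by rewrite /I; case: pselect => // p; exact: measurable_itv.
have lI k : (lebesgue_measure (I k) <= (C *+ 2)%:E * diam_pow s (U k))%E.
  have ge0 : (0 <= (C *+ 2)%:E * diam_pow s (U k))%E.
    by rewrite mule_ge0 ?diam_pow_ge0// lee_fin mulrn_wge0// ltW.
  rewrite /I; case: pselect => [p|_]; last by rewrite measure0.
  case: (cid p) => /= u [Uu _]; have [d0 dE] := diamfin _ _ Uu.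
  rewrite lebesgue_measure_itv/=; case: ifPn => // _.
  rewrite /diam_pow; case: ifPn => [/eqP Uk0|_]; first by rewrite Uk0 in Uu.
  rewrite -dE poweR_EFin -!EFinD -EFinM lee_fin; lra.
have : (lebesgue_measure (`]0%R, 1%R]%classic : set R) <=
        \sum_(0 <= k <oo) lebesgue_measure (I k))%E.
  apply: (@measure_sigma_subadditive _ _ _ (@lebesgue_measure R)) => //.
  move=> t t01; have : E (sigma t) by apply: sE; move: t01; rewrite /= in_itv.
  by move=> /EU[k _ Uk]; exists k => //; apply: VI; split.
rewrite lebesgue_measure_itv/= lte01 sube0.
apply/negP; rewrite -ltNge.
apply: (@le_lt_trans _ _ (\sum_(0 <= k <oo) (C *+ 2)%:E * diam_pow s (U k))%E).
  by apply: lee_nneseries => // k _ _; exact: measure_ge0.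
rewrite nneseriesZl; last by move=> *; exact: diam_pow_ge0.
apply: (@lt_trans _ _ ((C *+ 2)%:E * (C *+ 4)^-1%:E)%E).
  by rewrite lte_pmul2l// ?lte_fin ?pmulrn_lgt0.
rewrite -EFinM lte_fin -mulr_natr -(mulr_natr C 4) invfM.
rewrite mulrACA divff ?gt_eqF// mul1r; lra.
Qed.

Lemma hausdorff_dim_unit_eq1 E :
  E `<=` `]0, 1]%classic ->
  (forall s, 0 < s < 1 -> exists C sigma, [/\ 0 < C,
     forall t, 0 < t <= 1 -> E (sigma t) &
     forall t u, 0 < t <= 1 -> 0 < u <= 1 ->
       `|t - u| <= C * `|sigma t - sigma u| `^ s]) ->
  hausdorff_dim E = 1%E.
Proof.
move=> E01 Esigma; apply/eqP; rewrite eq_le hausdorff_dim_le1//=.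
apply: le_ereal_inf_tmp => _ [s [s0 Hs0] <-]; rewrite lee_fin leNgt; apply/negP => s1.
(* [s] may be 0, while the midpoint of [s] and 1 is a positive exponent below 1. Lowering it to [s]
   only enlarges powers of distances at most 1. *)
have [|C [sigma [C0 sE sC]]] := Esigma ((1 + s) / 2); first by lra.
apply: (@hausdorff_measure_expanding_neq0 s E C sigma) => // t u t01 u01.
apply: (le_trans (sC t u t01 u01)); rewrite ler_pM2l//.
have /E01 := sE t t01; have /E01 := sE u u01; rewrite /= !in_itv/= => su st.
have [->|stu] := eqVneq (sigma t) (sigma u).
  by rewrite subrr normr0 powR0 ?powR_ge0// gt_eqF//; lra.
apply: ger_powR; last by lra.
by rewrite normr_gt0 subr_eq0 stu/= ler_norml; lra.
Qed.

End hausdorff_unit_interval.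

(** * Binary expansions and the doubling map *)

Section binary_digits.
Context {R : realType}.
Implicit Types (e f : nat -> bool) (x t u : R).

(** Reading starts at position [n], so that the doubling map becomes the passage from [n] to
    [n.+1]. *)
Definition bin_psum e n m : R := \sum_(i < m) (e (n + i)%N)%:R / 2 ^+ i.+1.

Definition bin_val e n : R := limn (bin_psum e n).

Lemma bin_psumS e n m :
  bin_psum e n m.+1 = ((e n)%:R + bin_psum e n.+1 m) / 2.
Proof.
rewrite /bin_psum big_ord_recl/= addn0 expr1 mulrDl; congr (_ + _).
rewrite mulr_suml; apply: eq_bigr => i _.
by rewrite /bump/= add1n addnS addSn [in LHS]exprSr invfM mulrA.
Qed.

Lemma bin_psum_le1 e n m : bin_psum e n m <= 1.
Proof.
elim: m n => [|m IHm] n; first by rewrite /bin_psum big_ord0.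
by rewrite bin_psumS; have := IHm n.+1; case: (e n) => /=; lra.
Qed.

Lemma bin_psum_nondecreasing e n :
  {homo bin_psum e n : p q / (p <= q)%N >-> p <= q}.
Proof.
apply/nondecreasing_seqP => m.
by rewrite /bin_psum big_ord_recr/= lerDl divr_ge0// exprn_ge0.
Qed.

Lemma cvg_bin_psum e n : bin_psum e n @ \oo --> bin_val e n.
Proof.
apply: nondecreasing_is_cvgn; first exact: bin_psum_nondecreasing.
by exists 1 => _ [m _ <-]; exact: bin_psum_le1.
Qed.

Lemma bin_valS e n : bin_val e n = ((e n)%:R + bin_val e n.+1) / 2.
Proof.
apply: cvg_lim => //; rewrite -cvg_shiftS.
under eq_fun do rewrite /= bin_psumS.
apply: cvgMr_tmp; apply: cvgD; [exact: cvg_cst|exact: cvg_bin_psum].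
Qed.

Lemma bin_val_itv e n : 0 <= bin_val e n <= 1.
Proof.
apply/andP; split; last first.
  apply: limr_le; first by apply: cvgP; exact: cvg_bin_psum.
  by apply: nearW => m; exact: bin_psum_le1.
apply: limr_ge; first by apply: cvgP; exact: cvg_bin_psum.
apply: nearW => m; apply: sumr_ge0 => i _.
by rewrite divr_ge0// exprn_ge0.
Qed.

Lemma bin_val_ge_digit e n i : e (n + i)%N -> 2 ^- i.+1 <= bin_val e n.
Proof.
elim: i n => [|i IHi] n; rewrite bin_valS.
  by rewrite addn0 => -> /=; have := bin_val_itv e n.+1; rewrite expr1; lra.
rewrite addnS -addSn => /IHi IH; rewrite exprS invfM.
by case: (e n) => /=; lra.
Qed.

Lemma bin_val_zeros e n l : (forall i, (i < l)%N -> e (n + i)%N = false) ->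
  bin_val e n = bin_val e (n + l)%N / 2 ^+ l.
Proof.
elim: l n => [|l IHl] n el; first by rewrite addn0 expr0 divr1.
rewrite bin_valS IHl => [|i il]; last by rewrite addSn -addnS el.
have := el 0 (ltn0Sn _); rewrite addn0 => -> /=.
by rewrite add0r addSn addnS exprSr invfM mulrA.
Qed.

Lemma bin_val_ones e n l : (forall i, (i < l)%N -> e (n + i)%N) ->
  1 - 2 ^- l <= bin_val e n.
Proof.
elim: l n => [|l IHl] n el; first by rewrite expr0 invr1; have := bin_val_itv e n; lra.
have /IHl : forall i, (i < l)%N -> e (n.+1 + i)%N.
  by move=> i il; rewrite addSn -addnS el.
have := el 0 (ltn0Sn _); rewrite addn0 [bin_val e n]bin_valS exprS invfM => -> /=.
lra.
Qed.

(** Two values differ by 1 only for the expansions 000... and 111...; one common digit prevents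
    this. *)
Lemma bin_val_agree e f n i : e (n + i)%N = f (n + i)%N ->
  `|bin_val e n - bin_val f n| <= 1 - 2 ^- i.+1.
Proof.
elim: i n => [|i IHi] n; rewrite !(bin_valS _ n) ler_norml.
  rewrite addn0 => ->; have := bin_val_itv e n.+1.
  by have := bin_val_itv f n.+1; rewrite expr1; lra.
rewrite addnS -addSn => /IHi; rewrite [in 2 ^- i.+2]exprS invfM ler_norml.
by case: (e n); case: (f n) => /=; lra.
Qed.

Lemma bin_val_prefix e f n m : (forall i, (i < m)%N -> e (n + i)%N = f (n + i)%N) ->
  bin_val e n - bin_val f n =
  (bin_val e (n + m)%N - bin_val f (n + m)%N) / 2 ^+ m.
Proof.
elim: m n => [|m IHm] n efm; first by rewrite addn0 expr0 divr1.
have /IHm IH : forall i, (i < m)%N -> e (n.+1 + i)%N = f (n.+1 + i)%N.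
  by move=> i im; rewrite addSn -addnS efm.
have := efm 0 (ltn0Sn _); rewrite addn0 !(bin_valS _ n) => ->.
rewrite -mulrBl opprD addrACA subrr add0r IH.
by rewrite addSn addnS exprSr invfM mulrA.
Qed.

(** At the first difference [m] the digits differ by 1, and by [bin_val_agree] the tails after it
    cannot cancel this completely. *)
Lemma bin_val_dist e f m i :
  (forall j, (j < m)%N -> e j = f j) -> e m != f m ->
  e (m.+1 + i)%N = f (m.+1 + i)%N ->
  2 ^- (m + i.+2) <= `|bin_val e 0 - bin_val f 0|.
Proof.
move=> efm nefm /bin_val_agree; rewrite (@bin_val_prefix _ _ 0 m)// add0n => h.
rewrite normrM normfV [`|2 ^+ m|]ger0_norm ?exprn_ge0// exprD invfM mulrC.
rewrite ler_pM2r ?invr_gt0 ?exprn_gt0// exprS invfM ler_normr !(bin_valS _ m).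
by move: h nefm; rewrite ler_norml; case: (e m); case: (f m) => //= ? _;
  apply/orP; [left|right]; lra.
Qed.

(** If the tail were 0, the ceiling convention would return 1 instead. *)
Lemma doubling_bin_val e n : 0 < bin_val e n.+1 ->
  doubling (bin_val e n) = bin_val e n.+1.
Proof.
move=> en0; have := bin_val_itv e n.+1 => en.
rewrite /doubling (bin_valS e n) mulrC divfK//.
rewrite (@ceil_def _ _ (Posz (e n) + 1)); last first.
  by rewrite addrK intrD; apply/andP; split; case: (e n) => /=; lra.
by rewrite intrD; case: (e n) => /=; lra.
Qed.

Lemma iter_doubling_bin_val e n : (forall i, 0 < bin_val e i) ->
  iter n (@doubling R) (bin_val e 0) = bin_val e n.
Proof.
move=> e0; elim: n => // n IHn.
by rewrite iterS IHn doubling_bin_val.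
Qed.

(** The strict comparison gives 1/2 the digit 0: dyadic points are read with the expansion that ends
    in ones. *)
Lemma doublingE t : 0 < t <= 1 -> doubling t = t *+ 2 - (1 / 2 < t)%R%:R.
Proof.
move=> t01; rewrite /doubling; case: ltP => t2.
  rewrite (@ceil_def _ _ 2); first by rewrite /=; lra.
  by rewrite /=; apply/andP; split; lra.
rewrite (@ceil_def _ _ 1); first by rewrite /=; lra.
by rewrite /=; apply/andP; split; lra.
Qed.

Lemma iter_doubling_itv t n : 0 < t <= 1 -> 0 < iter n (@doubling R) t <= 1.
Proof. by case: n => // n _; exact: doublingP. Qed.

End binary_digits.

(** * Coding a parameter into the free positions *)

Section coding.
Context {R : realType}.
Variables (fixed : pred nat) (dig : nat -> bool).
Implicit Types (t u : R).

Definition free_count m := (\sum_(i < m) ~~ fixed i)%N.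

Definition digit_code t i : bool :=
  if fixed i then dig i else 1 / 2 < iter (free_count i) (@doubling R) t.

Lemma digit_code_prefix t u m : 0 < t <= 1 -> 0 < u <= 1 ->
  (forall i, (i < m)%N -> digit_code t i = digit_code u i) ->
  `|t - u| <= 2 ^- free_count m.
Proof.
move=> t01 u01 tu.
(* While the digits of [t] and [u] agree, the doubling map acts on both by the same affine branch
   and exactly doubles their difference. *)
have tail : 2 ^+ free_count m * (t - u) =
    iter (free_count m) (@doubling R) t - iter (free_count m) (@doubling R) u.
  elim: m tu => [|m IHm] tu; first by rewrite /free_count big_ord0 expr0 mul1r.
  have /IHm : forall i, (i < m)%N -> digit_code t i = digit_code u i.
    by move=> i im; apply: tu; rewrite ltnW.
  have := tu m (ltnSn _);
    rewrite /digit_code /free_count big_ord_recr /= -/(free_count m).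
  case: ifP => _ /=; first by rewrite addn0.
  rewrite addn1 !iterS !doublingE ?iter_doubling_itv// => -> IH.
  by rewrite exprS -mulrA IH; lra.
rewrite -[t - u](mulKf (_ : 2 ^+ free_count m != 0)) ?expf_neq0//.
rewrite tail normrM normfV [`|2 ^+ _|]ger0_norm ?exprn_ge0//.
rewrite ler_piMr ?invr_ge0 ?exprn_ge0//.
have := iter_doubling_itv (free_count m) t01.
by have := iter_doubling_itv (free_count m) u01; rewrite ler_norml; lra.
Qed.

(* A fixed position shortly after the first difference prevents codings of
   distinct points from being as close as .0111... and .1000... *)
Lemma digit_code_expanding (s c : R) (N : nat) : 0 < s ->
  (forall m, s * m%:R - c <= (free_count m)%:R) ->
  (forall m, exists2 i, (i < N)%N & fixed (m + i)%N) ->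
  exists2 C, 0 < C & forall t u, 0 < t <= 1 -> 0 < u <= 1 ->
    `|t - u| <= C * `|bin_val (digit_code t) 0 - bin_val (digit_code u) 0| `^ s.
Proof.
(* If [m] is the first difference, then |t - u| is at most 2^(c - s m), and the codes are at least
   2^-(m + N + 1) apart; the constant is the quotient of the first bound by the [s]-th power of the
   second. *)
move=> s0 dens gap; exists (2 `^ (c + s * N.+1%:R)); first exact: powR_gt0.
move=> t u t01 u01.
have [->|tu] := eqVneq t u.
  by rewrite subrr normr0 mulr_ge0 ?powR_ge0.
have [m cm cmin] : exists2 m, digit_code t m != digit_code u m &
    forall i, (i < m)%N -> digit_code t i = digit_code u i.
  have [[m cm]|nodiff] := pselect (exists m, digit_code t m != digit_code u m).
    have ex : exists m, (fun m => digit_code t m != digit_code u m) m by exists m.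
    case: (ex_minnP ex) => m' cm' m'min; exists m' => // i im';
      apply/eqP/negPn/negP => /m'min.
    by rewrite leqNgt im'.
  (* Equal codes would force |t - u| below 2^-(free count) for every prefix, and the free count is
     unbounded. *)
  exfalso; have tu0 : 0 < `|t - u| by rewrite normr_gt0 subr_eq0.
  pose K := Num.truncn (`|t - u|^-1); pose m := Num.truncn ((K.+1%:R + c) / s).
  have Km : (K.+1 <= free_count m.+1)%N.
    rewrite -(ler_nat R); apply: le_trans (dens _).
    have : (K.+1%:R + c) / s < m.+1%:R by exact: truncnS_gt.
    by rewrite ltr_pdivrMr// mulrC => ?; lra.
  have := @digit_code_prefix t u m.+1 t01 u01.
  have /[swap] /[apply] : forall i, (i < m.+1)%N -> digit_code t i = digit_code u i.
    by move=> i _; apply/eqP/negPn/negP => ci; apply: nodiff; exists i.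
  apply/negP; rewrite -ltNge invf_plt ?posrE ?exprn_gt0//.
  apply: (@lt_le_trans _ _ K.+1%:R); first exact: truncnS_gt.
  apply: (@le_trans _ _ (2 ^+ K.+1)); last by rewrite ler_weXn2l// ler1n.
  by rewrite -natrX ler_nat ltnW// ltn_expl.
have [i iN fi] := gap m.+1.
have dist : 2 ^- (m + i.+2) <= `|bin_val (digit_code t) 0 - bin_val (digit_code u)
  0 : R|.
  by apply: bin_val_dist => //; rewrite /digit_code fi.
apply: (le_trans (digit_code_prefix t01 u01 cmin)).
apply: (@le_trans _ _ (2 `^ (c + s * N.+1%:R) * (2 `^ (- (m + N.+1)%:R)) `^ s)).
  rewrite -powRrM -powRD ?pnatr_eq0 ?implybT//.
  rewrite -powR_mulrn// -powRN ler_powR ?ler1n//.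
  by have := dens m; rewrite natrD; lra.
rewrite ler_pM2l ?powR_gt0// ge0_ler_powR ?nnegrE ?powR_ge0 ?(ltW s0)//.
apply: le_trans dist;
  rewrite powRN powR_mulrn// lef_pV2 ?posrE ?exprn_gt0// ler_weXn2l ?ler1n//.
by rewrite leq_add2l ltnS.
Qed.

End coding.

(** * Combinatorics of the prescribed words *)

Section blocks.
Local Open Scope nat_scope.
(* The j-th block is the word 1 0^(k j) 1^(k j + 1) placed at position b j. *)
Variables b k : nat -> nat.
Hypothesis block_gap : forall j, b j + (k j).*2.+2 <= b j.+1.
Implicit Types i j l m n : nat.

(** Only indices [j <= i] can matter, because [j <= b j]; bounding them makes the predicate
    boolean. *)
Definition in_block i := [exists j : 'I_i.+1, b j <= i < b j + (k j).*2.+2].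

Definition in_zeros i := [exists j : 'I_i.+1, b j < i <= b j + k j].

(** The exponent counts the zeros from position [i] on. *)
Definition weight i :=
  \sum_(j < i.+1) if b j < i <= b j + k j then 2 ^ (b j + k j + 1 - i) else 0.

Definition weight_sum n := \sum_(i < n) weight i.

Lemma block_ltS j : b j < b j.+1.
Proof. have := block_gap j; lia. Qed.

Lemma block_leq : {homo b : i j / i <= j}.
Proof.
by apply: homo_leq => [//|/= j i l|i]; [exact: leq_trans|exact/ltnW/block_ltS].
Qed.

Lemma leq_block j : j <= b j.
Proof. by elim: j => // j IHj; apply: leq_ltn_trans IHj (block_ltS j). Qed.

Lemma block_index n : b 0 <= n -> exists j, b j <= n < b j.+1.
Proof.
move=> b0n; have ex : exists j, b j <= n by exists 0.
have bound j : b j <= n -> j <= n by apply: leq_trans (leq_block j).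
case: (ex_maxnP ex bound) => j bj jmax; exists j; rewrite bj ltnNge.
by apply/negP => /jmax; rewrite ltnn.
Qed.

Lemma block_uniq i j l : b j <= i < b j.+1 -> b l <= i < b l.+1 -> j = l.
Proof.
move=> /andP[ji ij] /andP[li il]; apply/eqP; rewrite eqn_leq.
apply/andP; split; rewrite leqNgt; apply/negP => /block_leq; lia.
Qed.

Section in_one_block.
Variables i j : nat.
Hypothesis ij : b j <= i < b j.+1.

Let j_lt : j < i.+1.
Proof. by have := leq_block j; move/andP: ij => [? _];
  rewrite ltnS => /leq_trans ->. Qed.

Lemma in_blockE : in_block i = (i < b j + (k j).*2.+2).
Proof.
apply/existsP/idP => [[l li]|h].
  suff -> : j = l by case/andP: li.
  by apply: block_uniq ij _; have := block_gap l; lia.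
by exists (Ordinal j_lt) => /=; rewrite h; case/andP: ij => ->.
Qed.

Lemma in_zerosE : in_zeros i = (b j < i <= b j + k j).
Proof.
apply/existsP/idP => [[l li]|h]; last by exists (Ordinal j_lt).
suff -> : j = l by [].
by apply: block_uniq ij _; have := block_gap l; lia.
Qed.

Lemma weightE :
  weight i = if b j < i <= b j + k j then 2 ^ (b j + k j + 1 - i) else 0.
Proof.
rewrite /weight (bigD1 (Ordinal j_lt))//= big1 ?addn0// => l lj.
case: ifP => // li; case/eqP: lj; apply: val_inj => /=.
by apply: block_uniq ij; have := block_gap l; lia.
Qed.

End in_one_block.

Lemma no_block i : i < b 0 -> (in_block i = false) * (in_zeros i = false).
Proof.
move=> i0; have bl (l : 'I_i.+1) : i < b l by exact: leq_trans i0 (block_leq _).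
by split; apply/negbTE/negP => /existsP[l]; have := bl l; lia.
Qed.

Lemma in_zerosP i : reflect (exists j, b j < i <= b j + k j) (in_zeros i).
Proof.
apply: (iffP existsP) => [[j ji]|[j ji]]; first by exists j.
have j_lt : j < i.+1 by have := leq_block j; lia.
by exists (Ordinal j_lt).
Qed.

Lemma in_zerosN_weight i : ~~ in_zeros i -> weight i = 0.
Proof.
move=> iz; rewrite /weight big1// => j _; case: ifP => // ji.
by case/in_zerosP: iz; exists j.
Qed.

Lemma in_zeros_in_block i : in_zeros i -> in_block i.
Proof. by move=> /existsP[j ij]; apply/existsP; exists j; lia. Qed.

Lemma in_block_start j : in_block (b j) && ~~ in_zeros (b j).
Proof.
have ij : b j <= b j < b j.+1 by rewrite leqnn block_ltS.
by rewrite (in_blockE ij) (in_zerosE ij); lia.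
Qed.

Lemma leq_weight_sum m n : m <= n -> weight_sum m <= weight_sum n.
Proof.
move=> mn; rewrite /weight_sum -!(big_mkord xpredT weight).
by rewrite (big_cat_nat (leq0n m) mn)//= leq_addr.
Qed.

(** The geometric sum 2^q + ... + 2; offset 0 is the leading 1, and offsets above [q] lie behind the
    run. *)
Lemma sum_zero_run q g : q < g ->
  \sum_(l < g) (if 0 < l <= q then 2 ^ (q + 1 - l) else 0) = 2 ^ q.+1 - 2.
Proof.
move=> qg; rewrite -(big_mkord xpredT (fun l => if 0 < l <= q then 2 ^ (q + 1 - l)
  else 0)).
rewrite (big_cat_nat (n := q.+1))//= [X in _ + X = _]big_nat_cond [X in _ + X =
  _]big1 ?addn0; last first.
  by move=> l ?; case: ifP => //; lia.
rewrite big_mkord big_ord_recl /= add0n.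
elim: {g qg} q => [|q IHq]; first by rewrite big_ord0.
rewrite big_ord_recl /= /bump /= addn1 subn1 /=.
rewrite (eq_bigr (fun l : 'I_q => if 0 < 1 + l <= q then 2 ^ (q + 1 - (1 + l)) else 0)).
  have := expn_gt0 2 q.+1; have := IHq; rewrite /bump/= => ->.
  by rewrite [2 ^ q.+2]expnS [2 ^ q.+1]expnS; lia.
by move=> l _; rewrite /bump/= (_ : q.+2 - _ = q + 1 - (1 + l))//; lia.
Qed.

Lemma weight_sum_block j : weight_sum (b j) = \sum_(i < j) (2 ^ (k i).+1 - 2).
Proof.
elim: j => [|j IHj].
  rewrite big_ord0 /weight_sum big1// => i _; apply: in_zerosN_weight.
  by rewrite no_block.
rewrite big_ord_recr/= -IHj /weight_sum -!(big_mkord xpredT weight).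
rewrite (big_cat_nat (n := b j))//=; last exact/ltnW/block_ltS.
congr (_ + _); have := big_addn 0 (b j.+1) (b j) xpredT weight.
rewrite add0n => ->; rewrite big_mkord.
have kg : k j < b j.+1 - b j by have := block_gap j; lia.
rewrite -(sum_zero_run kg); apply: eq_bigr => l _.
rewrite (@weightE _ j); last by have := ltn_ord l; lia.
rewrite (_ : (_ < _ <= _) = (0 < l <= k j)); last by lia.
by case: ifP => // _; congr (_ ^ _); lia.
Qed.

Definition block_count m := \sum_(i < m) in_block i.

Lemma leq_block_count m n : m <= n -> block_count m <= block_count n.
Proof.
move=> mn; rewrite /block_count -!(big_mkord xpredT (fun i => nat_of_bool (in_block
  i))).
by rewrite (big_cat_nat (leq0n m) mn)//= leq_addr.
Qed.

Lemma block_countS j : block_count (b j.+1) <= block_count (b j) + (k j).*2.+2.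
Proof.
rewrite /block_count -!(big_mkord xpredT (fun i => nat_of_bool (in_block i))).
rewrite (big_cat_nat (n := b j))//=; last exact/ltnW/block_ltS.
rewrite leq_add2l (big_cat_nat (n := b j + (k j).*2.+2))//=; last by rewrite leq_addr.
rewrite [X in _ + X]big_nat_cond [X in _ + X]big1 => [|i]; last first.
  by move=> i_in; rewrite (@in_blockE _ j); lia.
rewrite addn0 (leq_trans (leq_sum _ (fun _ _ => leq_b1 _)))//.
by rewrite sum_nat_const_nat; lia.
Qed.

(** The length of a block is charged to the gap preceding its start. Everything before [b j.+1] is
    thus paid for by positions before [b j], and the estimate also holds when [m] lies inside a
    block. *)
Lemma block_density M J : 
  (forall j, J <= j -> M * (k j.+1).*2.+2 <= b j.+1 - b j) ->
  forall m, M * block_count m <= m + M * block_count (b J.+1).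
Proof.
move=> sparse; set c := M * _.
have step l : M * block_count (b (J + l).+1) <= b (J + l) + c.
  elim: l => [|l IHl]; first by rewrite addn0 leq_addl.
  rewrite addnS (leq_trans (leq_mul (leqnn M) (block_countS _)))// mulnDr.
  have := sparse (J + l) (leq_addr _ _).
  by have := block_leq (leqnSn (J + l)); move: IHl; lia.
move=> m; have [mb|mb] := leqP m (b J.+1).
  by rewrite (leq_trans _ (leq_addl _ _))// leq_mul2l leq_block_count ?orbT.
have [|j /andP[jm mj]] := @block_index m.
  by rewrite (leq_trans _ (ltnW mb))// block_leq.
have Jj : J <= j.
  by rewrite leqNgt; apply/negP => /block_leq; move: mj (block_ltS J) mb; lia.
have := step (j - J); rewrite subnKC// => h.
apply: (@leq_trans (M * block_count (b j.+1))).
  by rewrite leq_mul2l leq_block_count ?orbT// ltnW.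
by rewrite (leq_trans h)// leq_add2r.
Qed.

End blocks.

(** * Birkhoff sums of the coded points *)

Section block_sequences.
Context {R : realType}.
Variables b k : nat -> nat.
Hypothesis block_gap : forall j, (b j + (k j).*2.+2 <= b j.+1)%N.

Local Notation S n x := (birkhoff_sum (@doubling R) (fun y => y^-1) n x).

Section weight_approximation.
Variables (N : nat) (e : nat -> bool).
Hypothesis N_gt0 : (0 < N)%N.
Hypothesis e_zeros : forall i, in_zeros b k i -> e i = false.
Hypothesis e_ones : forall i,
  ~~ in_zeros b k i -> in_block b k i || (N %| i)%N -> e i.

(** The next multiple of [N] carries a 1, unless it falls into a zero run; then the leading 1 of
    that block comes earlier. *)
Lemma next_one i : ~~ in_zeros b k i -> exists2 l, (l < N)%N & e (i + l)%N.
Proof.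
move=> iz; have [iN|iN] := boolP (N %| i)%N.
  by exists 0%N => //; rewrite addn0; apply: e_ones => //; rewrite iN orbT.
pose l := (N - i %% N)%N.
have im : (0 < i %% N < N)%N by rewrite ltn_pmod// lt0n -/(N %| i)%N iN.
have ilN : (N %| i + l)%N.
  rewrite {1}(divn_eq i N) -addnA subnKC ?dvdn_add ?dvdn_mull//.
  by case/andP: im => _ /ltnW.
have [ilz|ilz] := boolP (in_zeros b k (i + l)).
  have /in_zerosP-/(_ block_gap)[j jl] := ilz.
  have /andP[bj bjz] := in_block_start block_gap j.
  have ij : (i <= b j)%N.
    rewrite leqNgt; apply/negP => ji; case/negP: iz.
    by apply/(in_zerosP block_gap); exists j; lia.
  exists (b j - i)%N; first by move: jl im; rewrite /l; lia.
  by rewrite subnKC//; apply: e_ones => //; rewrite bj.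
exists l; first by move: im; rewrite /l; lia.
by apply: e_ones => //; rewrite ilN orbT.
Qed.

Lemma bin_val_ge_notin_zeros i : ~~ in_zeros b k i -> 2 ^- N <= bin_val e i :> R.
Proof.
move=> /next_one[l lN il]; apply: le_trans (bin_val_ge_digit il).
by rewrite lef_pV2 ?posrE ?exprn_gt0// ler_weXn2l// ler1n.
Qed.

(** Outside the runs the weight is 0 and a 1 follows within [N] digits. Inside, l zeros are followed
    by more than l ones, so the value is v / 2^l with v between 1 - 2^-(l+1) and 1, and its inverse
    exceeds 2^l by at most 1. *)
Lemma inv_bin_val_weight i : (0 < bin_val e i :> R) /\
  (weight b k i)%:R <= (bin_val e i : R)^-1 <= (weight b k i)%:R + 2 ^+ N.
Proof.
have [iz|iz] := boolP (in_zeros b k i); last first.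
  have ei := bin_val_ge_notin_zeros iz.
  have ei0 : 0 < bin_val e i :> R by apply: lt_le_trans ei; rewrite invr_gt0 exprn_gt0.
  by rewrite (in_zerosN_weight block_gap iz) invr_ge0 ltW//= add0r invf_ple
    ?posrE// exprn_gt0.
have [j ji] := in_zerosP block_gap _ iz.
have ij : (b j <= i < b j.+1)%N by have := block_gap j; lia.
rewrite (weightE block_gap ij) ji.
set l := (b j + k j + 1 - i)%N.
have lk : (0 < l <= k j)%N by rewrite /l; lia.
have zeros q : (q < l)%N -> e (i + q)%N = false.
  move=> ql; apply: e_zeros; apply/(in_zerosP block_gap); exists j.
  by move: ql; rewrite /l; lia.
have ones q : (q < (k j).+1)%N -> e (i + l + q)%N.
  move=> qk; have ij' : (b j <= i + l + q < b j.+1)%N.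
    by have := block_gap j; move: qk; rewrite /l; lia.
  apply: e_ones; first by rewrite (in_zerosE block_gap ij'); rewrite /l; lia.
  by rewrite (in_blockE block_gap ij'); move: qk; rewrite /l; lia.
rewrite (bin_val_zeros zeros).
have := bin_val_ones (R := R) ones; have /andP[_] := @bin_val_itv R e (i + l).
set v := bin_val _ _ => v1 vk.
have kl : 2 ^- (k j).+1 <= 2 ^- l.+1 :> R.
  by rewrite lef_pV2 ?posrE ?exprn_gt0// ler_weXn2l ?ler1n//; lia.
have l1 : 2 ^- l.+1 <= 2 ^- 1 :> R.
  by rewrite lef_pV2 ?posrE ?exprn_gt0// ler_weXn2l ?ler1n//; lia.
have v0 : 0 < v by move: l1; rewrite expr1; lra.
have p0 : 0 < 2 ^+ l :> R by rewrite exprn_gt0.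
split; first by rewrite divr_gt0.
rewrite invfM invrK natrX -{1}[2 ^+ l]mul1r ler_pM2r// invf_ge1// v1/=.
apply: (@le_trans _ _ (2 ^+ l + 1)); last by rewrite lerD2l exprn_ege1// ler1n.
rewrite mulrC ler_pdivrMr// mulrDl mul1r.
have : 2 ^+ l * (1 - 2 ^- l.+1) <= 2 ^+ l * v by rewrite ler_pM2l//; lra.
rewrite mulrBr mulr1 exprSr invfM mulrA divff ?gt_eqF// => ?.
by move: l1; rewrite expr1; lra.
Qed.

Lemma birkhoff_sum_bin_val n :
  (weight_sum b k n)%:R <= S n (bin_val e 0) <=
  (weight_sum b k n)%:R + 2 ^+ N * n%:R.
Proof.
have Sn : S n (bin_val e 0) = \sum_(i < n) (bin_val e i)^-1.
  apply: eq_bigr => i _; rewrite iter_doubling_bin_val// => j.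
  by case: (inv_bin_val_weight j).
rewrite Sn /weight_sum natr_sum; apply/andP; split.
  by apply: ler_sum => i _; case: (inv_bin_val_weight i) => _ /andP[].
rewrite mulrC -[X in X%:R * _]card_ord mulr_natl -sumr_const -big_split/=.
by apply: ler_sum => i _; case: (inv_bin_val_weight i) => _ /andP[].
Qed.

End weight_approximation.

Lemma sum_dvdn N m : (0 < N)%N -> (N * (\sum_(i < m) (N %| i)) <= m + N)%N.
Proof.
move=> N0; case: m => [|m]; first by rewrite big_ord0 muln0.
suff -> : (\sum_(i < m.+1) (N %| i) = (m %/ N).+1)%N.
  by rewrite mulnS mulnC; have := leq_divM m N; lia.
elim: m => [|m IHm]; first by rewrite big_ord1 dvdn0 div0n.
by rewrite big_ord_recr/= IHm divnS//; lia.
Qed.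

Hypothesis block_sparse : forall M, exists J, forall j, (J <= j)%N ->
  (M * (k j.+1).*2.+2 <= b j.+1 - b j)%N.

(** Dimension 1 is reduced to an estimate on Birkhoff sums. [C] is universally quantified because
    the proof takes [2 ^+ N], where [N] grows as [s] tends to 1. *)
Lemma hausdorff_dim_block_sequences (E : set R) :
  E `<=` `]0, 1]%classic ->
  (forall x C, 0 < x <= 1 ->
    (forall n, (weight_sum b k n)%:R <= S n x <= (weight_sum b k n)%:R + C * n%:R) ->
    E x) ->
  hausdorff_dim E = 1%E.
Proof.
move=> E01 Ex; apply: hausdorff_dim_unit_eq1 => // s /andP[s0 s1].
(* Multiples of [N] and blocks each occupy a share of about 1/N, so at least a share [s] stays
   free. *)
have [N N0 Ns] : exists2 N, (0 < N)%N & 2 <= N%:R * (1 - s).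
  exists (Num.truncn (2 / (1 - s))).+1 => //.
  by rewrite -ler_pdivrMr ?subr_gt0// ltW// truncnS_gt.
pose fixed i := in_block b k i || (N %| i)%N.
pose dig i := ~~ in_zeros b k i.
have [J sparse] := block_sparse N.
pose c := (N * block_count b k (b J.+1) + N)%N.
have dens m : s * m%:R - c%:R <= (free_count fixed m)%:R.
  have mfree : (N * m <= N * free_count fixed m + m + m + c)%N.
    have := block_density block_gap sparse m; have := @sum_dvdn N m N0.
    suff : (m <= free_count fixed m + block_count b k m + \sum_(i < m) (N %| i))%N.
      rewrite -(leq_pmul2l N0) !mulnDr /c; set A := (N * _)%N; lia.
    rewrite /free_count /block_count -!big_split/= -{1}[m]muln1.
    rewrite -{1}[m]card_ord -sum_nat_const; apply: leq_sum => i _.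
    by rewrite /fixed; case: in_block; case: (N %| i)%N.
  have {mfree} : N%:R * m%:R <= N%:R * (free_count fixed m)%:R + m%:R + m%:R + c%:R
    :> R.
    by rewrite -!natrM -!natrD ler_nat.
  have N1 : 1 <= N%:R :> R by rewrite ler1n.
  have m0 : 0 <= m%:R :> R by [].
  have c0 : 0 <= c%:R :> R by [].
  move: Ns N1 m0 c0; set n := N%:R; set m' := m%:R; set c' := c%:R; set f := _%:R.
  move=> Ns N1 m0 c0 h; rewrite -(ler_pM2l (_ : 0 < n)); last by lra.
  have := ler_wpM2r m0 Ns; have := ler_wpM2r c0 N1; lra.
have gap m : exists2 i, (i < N)%N & fixed (m + i)%N.
  have mN : (m %% N < N)%N by rewrite ltn_pmod.
  have [mN0|mN0] := posnP (m %% N).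
    by exists 0%N => //; rewrite /fixed addn0 /dvdn mN0 orbT.
  exists (N - m %% N)%N; first by lia.
  have mdvd : (N %| m + (N - m %% N))%N.
    by rewrite {1}(divn_eq m N) -addnA subnKC ?dvdn_add ?dvdn_mull// ltnW.
  by rewrite /fixed mdvd orbT.
have [C C0 codeC] := digit_code_expanding (R := R) dig s0 dens gap.
exists C, (fun t => bin_val (digit_code fixed dig t) 0); split=> // t t01.
have czeros i : in_zeros b k i -> digit_code fixed dig t i = false.
  by move=> iz; rewrite /digit_code /fixed in_zeros_in_block// /dig iz.
have cones i : ~~ in_zeros b k i -> in_block b k i || (N %| i)%N ->
    digit_code fixed dig t i.
  by move=> iz fi; rewrite /digit_code /fixed fi.
apply: (Ex _ (2 ^+ N)); last exact: birkhoff_sum_bin_val.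
have [c0 _] := inv_bin_val_weight N0 czeros cones 0.
by rewrite c0; case/andP: (@bin_val_itv R (digit_code fixed dig t) 0).
Qed.

End block_sequences.

(** * Comparison of powers and logarithms, and eventual statements along blocks *)

Section power_growth.
Context {R : realType}.
Implicit Types A a gamma : R.

Lemma near_powR_ge A a : 0 < a -> \forall n \near \oo, A <= n%:R `^ a.
Proof.
move=> a0; near=> n.
have An : `|A| `^ a^-1 <= n%:R by near: n; exact: nbhs_infty_ger.
apply: (le_trans (ler_norm A)).
have -> : `|A| = (`|A| `^ a^-1) `^ a by rewrite -powRrM mulVf ?gt_eqF// powRr1.
by rewrite ge0_ler_powR ?nnegrE ?powR_ge0 ?(ltW a0).
Unshelve. all: by end_near. Qed.

Lemma near_ln_le_powR A a : 0 < a ->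
  \forall n \near \oo, A * ln n%:R <= n%:R `^ a.
Proof.
(* One half of the exponent dominates the logarithm, the other half the constant. *)
move=> a0; have a20 : 0 < a / 2 by rewrite divr_gt0.
near=> n.
have n0 : 0 < n%:R :> R by rewrite ltr0n; near: n; exact: nbhs_infty_gt.
have ln_n0 : 0 <= ln n%:R :> R by rewrite ln_ge0// ler1n -(ltr0n R).
have ln_n : a / 2 * ln n%:R <= n%:R `^ (a / 2).
  by rewrite -ln_powR ltW// ln_sublinear// powR_gt0.
have An : `|A| / (a / 2) <= n%:R `^ (a / 2) by near: n; exact: near_powR_ge.
apply: (@le_trans _ _ (`|A| * ln n%:R)); first by rewrite ler_wpM2r// ler_norm.
have -> : n%:R `^ a = n%:R `^ (a / 2) * n%:R `^ (a / 2) :> R.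
  by rewrite -powRD -?splitr// (gt_eqF n0) implybT.
have -> : `|A| * ln n%:R = (`|A| / (a / 2)) * (a / 2 * ln n%:R).
  by rewrite mulrA divfK ?gt_eqF.
by apply: ler_pM; rewrite // ?(mulr_ge0 (ltW a20))// divr_ge0// ltW.
Unshelve. all: by end_near. Qed.

(** The summand 1 absorbs the rounding of run lengths. *)
Lemma near_powR_le A gamma : 0 <= gamma < 1 ->
  \forall n \near \oo, A * (n%:R `^ gamma + 1) <= n%:R.
Proof.
move=> /andP[gamma0 gamma1]; near=> n.
have n0 : 1 <= n%:R :> R by rewrite ler1n; near: n; exact: nbhs_infty_gt.
have n1 : 1 <= n%:R `^ gamma :> R.
  by rewrite -{1}(powRr0 n%:R) ler_powR.
have An : `|A| *+ 2 <= n%:R `^ (1 - gamma).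
  by near: n; apply: near_powR_ge; rewrite subr_gt0.
have nE : n%:R = n%:R `^ (1 - gamma) * n%:R `^ gamma :> R.
  by rewrite -powRD ?subrK ?powRr1 ?gt_eqF ?implybT// (lt_le_trans _ n0).
apply: (@le_trans _ _ (`|A| *+ 2 * n%:R `^ gamma)); last first.
  by rewrite [leRHS]nE ler_wpM2r// powR_ge0.
apply: (@le_trans _ _ (`|A| * (n%:R `^ gamma + 1))).
  by rewrite ler_wpM2r ?ler_norm// addr_ge0// powR_ge0.
rewrite mulrDr mulr1 mulr2n mulrDl lerD2l ler_peMr//.
Unshelve. all: by end_near. Qed.

End power_growth.

Lemma near_infty_comp (b : nat -> nat) (P : set nat) : (forall j, (j <= b j)%N) ->
  (\forall n \near \oo, P n) -> \forall j \near \oo, P (b j).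
Proof.
move=> jb [N _ NP]; exists N => // j /= Nj; apply: NP => /=.
exact: leq_trans Nj (jb j).
Qed.

Lemma near_infty_blocks (b k : nat -> nat) (P : set nat) :
  (forall j, (b j + (k j).*2.+2 <= b j.+1)%N) ->
  (\forall j \near \oo, forall n, (b j <= n < b j.+1)%N -> P n) ->
  \forall n \near \oo, P n.
Proof.
move=> gap [J _ JP]; exists (b J) => // n /= Jn.
have [|j /andP[jn nj]] := @block_index b k gap n.
  by apply: leq_trans Jn; apply: (block_leq gap).
apply: (JP j) => /=; last by rewrite jn.
rewrite leqNgt; apply/negP => /(block_leq gap); move: nj Jn; lia.
Qed.

(** * Level sets for beta = 0 and beta = +oo *)

Section level_sets.
Context {R : realType}.
Implicit Types (Psi : nat -> R) (x beta gamma : R).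

Local Notation S n x := (birkhoff_sum (@doubling R) (fun y => y^-1) n x).

Lemma level_set_sub_unit Psi (beta : \bar R) : level_set Psi beta `<=` `]0, 1]%classic.
Proof. by move=> x [x01 _]; rewrite /= in_itv. Qed.

Lemma level_setP Psi beta x :
  level_set Psi beta%:E x <-> 0 < x <= 1 /\ (S n x / Psi n) @[n --> \oo] --> beta.
Proof.
split=> -[x01 xbeta]; split=> //.
  by have /fine_cvgP[] := xbeta.
by apply: cvg_EFin => //; exact: nearW.
Qed.

Lemma hausdorff_dim_level_set0 Psi : (forall n, 0 <= Psi n) ->
  (n%:R / Psi n) @[n --> \oo] --> (0 : R) ->
  hausdorff_dim (level_set Psi 0%E) = 1%E.
Proof.
move=> Psi0 nPsi.
(* With no zeros each word is 11 and has weight 0; powers of two make the words sparse. *)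
have gap j : (2 ^ j.+1 + 0.*2.+2 <= 2 ^ j.+2)%N.
  by rewrite [X in (_ <= X)%N]expnS; have := expn_gt0 2 j; rewrite !expnS; lia.
apply: (hausdorff_dim_block_sequences gap); last 2 first.
- exact: level_set_sub_unit.
- move=> x C x01 xC; apply/level_setP; split=> //.
  have w0 n : weight_sum (fun j => 2 ^ j.+1)%N (fun=> 0%N) n = 0%N.
    rewrite /weight_sum big1// => i _; apply: (in_zerosN_weight gap).
    by apply/(in_zerosP gap) => -[j]; lia.
  apply: (@squeeze_cvgr _ _ _ _ (fun=> 0) (fun n => C * (n%:R / Psi n))).
  + apply: nearW => n; have := xC n; rewrite w0 add0r => /andP[S0 SC].
    by rewrite divr_ge0//= mulrA ler_wpM2r// invr_ge0.
  + exact: cvg_cst.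
  + by rewrite -[X in _ --> X](mulr0 C); apply: cvgMl_tmp.
move=> M; exists M => j Mj; rewrite [X in (_ <= X - _)%N]expnS.
have := ltn_expl j (ltnSn 1); rewrite !expnS.
by move: (2 ^ j)%N => p; lia.
Qed.

Lemma hausdorff_dim_level_set_pinfty Psi gamma : 0 < gamma < 1 ->
  (\forall n \near \oo, 0 < Psi n <= 2 `^ (n%:R `^ gamma)) ->
  hausdorff_dim (level_set Psi +oo%E) = 1%E.
Proof.
move=> /andP[gamma0 gamma1] Psi_le.
pose b j := (2 ^ j.+1)%N.
(* The weight of block [j] is complete at [b j.+1] and has to serve all [n] up to [b j.+2]; the
   factor 2 makes it exceed the square of the bound on [Psi n]. *)
pose q j := (Num.truncn (2 * (b j.+2)%:R `^ gamma)).+1.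
(* The finitely many runs that do not fit are dropped. *)
pose k j := if ((q j).*2.+2 <= b j)%N then q j else 0%N.
have bS j : (b j.+1 = 2 * b j)%N by rewrite /b expnS.
have b_gt j : (j.+1 < b j)%N by rewrite /b ltn_expl.
have gap j : (b j + (k j).*2.+2 <= b j.+1)%N.
  by rewrite /k bS; have := b_gt j; case: ifP; lia.
have kq j : (k j <= q j)%N by rewrite /k; case: ifP.
have sparse M : \forall j \near \oo, (M * (q j.+1).*2.+2 <= b j)%N.
  have b3 j : (j <= b j.+3)%N by have := b_gt j.+3; lia.
  have gamma01 : 0 <= gamma < 1 by rewrite ltW.
  (* 32 = 4 * 8: a block has length at most 4 (y + 1) with y the power of [b j.+3], which is 8 times
     [b j]. *)
  have [J _ JP] := near_infty_comp b3 (near_powR_le (M%:R *+ 32) gamma01).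
  exists J => // j /JP /=; rewrite -(ler_nat R) natrM.
  have -> : (b j.+3)%:R = 8 * (b j)%:R :> R by rewrite !bS !natrM; lra.
  have : (q j.+1)%:R <= 2 * (b j.+3)%:R `^ gamma + 1.
    by rewrite /q -natr1 lerD2r truncn_le mulr_ge0// powR_ge0.
  have -> : (b j.+3)%:R = 8 * (b j)%:R :> R by rewrite !bS !natrM; lra.
  set y := _ `^ gamma => qy yb.
  have : M%:R * (q j.+1).*2.+2%:R <= M%:R * (4 * y + 4).
    rewrite ler_wpM2l// -2!natr1 -muln2 natrM; lra.
  lra.
apply: (hausdorff_dim_block_sequences gap); last 2 first.
- exact: level_set_sub_unit.
- move=> x C x01 xC; split=> //; apply/cvgeryP/cvgryPge => A.
  have w_large : \forall n \near \oo,
      2 `^ (2 * n%:R `^ gamma) <= (weight_sum b k n)%:R :> R.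
    apply: (near_infty_blocks gap).
    have [J _ JP] := sparse 1%N; exists J.+2 => // -[|[|j]] //= Jj n /andP[jn nj].
    have kj : k j.+1 = q j.+1.
      rewrite /k ifT//; have := JP j Jj; rewrite mul1n => /leq_trans; apply.
      by rewrite bS; lia.
    apply: (@le_trans _ _ (2 ^ k j.+1)%N%:R); last first.
      rewrite ler_nat; apply: leq_trans (leq_weight_sum b k jn).
      rewrite weight_sum_block// big_ord_recr/=; apply: leq_trans (leq_addl _ _).
      rewrite expnS kj /q; have : (0 < 2 ^ Num.truncn (2 * (b j.+3)%:R `^ gamma))%N.
        by rewrite expn_gt0.
      by rewrite expnS; lia.
    rewrite natrX -powR_mulrn// ler_powR ?ler1n// kj.
    apply: (@le_trans _ _ (2 * (b j.+3)%:R `^ gamma)); last first.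
      by rewrite ltW// truncnS_gt.
    by rewrite ler_pM2l// ge0_ler_powR ?nnegrE ?(ltW gamma0)// ler_nat (ltnW nj).
  near=> n.
  have /andP[Psi0 Psi_n] : 0 < Psi n <= 2 `^ (n%:R `^ gamma) by near: n.
  have An : `|A| / ln 2 <= n%:R `^ gamma by near: n; exact: near_powR_ge.
  have wn : 2 `^ (2 * n%:R `^ gamma) <= (weight_sum b k n)%:R :> R by near: n.
  have /andP[wS _] := xC n; rewrite ler_pdivlMr//.
  apply: (le_trans _ (le_trans wn wS)).
  (* One of the two factors dominates [Psi n], the other [A]. *)
  rewrite (_ : 2 * n%:R `^ gamma = n%:R `^ gamma + n%:R `^ gamma); last by lra.
  rewrite powRD ?pnatr_eq0 ?implybT//.
  apply: (@le_trans _ _ (2 `^ (n%:R `^ gamma) * Psi n)); last first.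
    by rewrite ler_wpM2l// powR_ge0.
  apply: ler_wpM2r; first exact: ltW.
  apply: (le_trans (ler_norm A)); rewrite /powR pnatr_eq0/=.
  apply: (@le_trans _ _ (n%:R `^ gamma * ln 2)).
    by rewrite -ler_pdivrMr// ln_gt0// ltr1n.
  by apply: le_trans (expR_ge1Dx _); rewrite lerDr.
move=> M; have [J _ JP] := sparse M; exists J => j /JP /=.
rewrite bS => Mq; apply: (@leq_trans (M * (q j.+1).*2.+2)); last by lia.
by rewrite leq_mul2l; have := kq j.+1; lia.
Unshelve. all: by end_near. Qed.
End level_sets.

(** * Greedy choice of the run lengths *)

Section greedy.
Context {R : realType}.
Implicit Types (Phi Psi rho delta : nat -> R).

(** Once [delta] is at most eps/2, the number eps/2 is a fixed point of the bounding recursion, and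
    the excess over it halves at each step. *)
Lemma cvg0_halving rho delta : (forall j, 0 <= rho j) ->
  (\forall j \near \oo, rho j.+1 <= (rho j + delta j) / 2) ->
  delta @ \oo --> 0 -> rho @ \oo --> 0.
Proof.
move=> rho0 [J1 _ J1P] /cvgrPdist_le d0; apply/cvgrPdist_le => eps eps0.
have eps20 : 0 < eps / 2 by rewrite divr_gt0.
have [J2 _ J2P] := d0 _ eps20.
pose J := maxn J1 J2.
have rec n : rho (J + n)%N <= eps / 2 + rho J / 2 ^+ n.
  elim: n => [|n IHn]; first by rewrite addn0 expr0 divr1 lerDr ltW.
  have /J1P : (J1 <= J + n)%N by rewrite (leq_trans (leq_maxl J1 J2))// leq_addr.
  have /J2P : (J2 <= J + n)%N by rewrite (leq_trans (leq_maxr J1 J2))// leq_addr.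
  rewrite /= sub0r normrN ler_norml addnS exprSr invfM mulrA => /andP[_ ?] ?; lra.
pose K := Num.truncn (rho J / (eps / 2)).
exists (J + K.+1)%N => // n /= JKn.
rewrite sub0r normrN ger0_norm// -(subnKC (_ : (J <= n)%N)); last by lia.
apply: (le_trans (rec _)); rewrite [leRHS](splitr eps) lerD2l.
rewrite ler_pdivrMr ?exprn_gt0// mulrC -ler_pdivrMr//.
apply: (@le_trans _ _ K.+1%:R); first by rewrite ltW// truncnS_gt.
apply: (@le_trans _ _ (n - J)%:R); first by rewrite ler_nat; lia.
by rewrite -natrX ler_nat ltnW// ltn_expl.
Qed.

(** For [y >= 0], the largest d with 2^(d+1) - 2 <= y: the longest run whose block has weight at
    most [y]. *)
Definition log2_deg (y : R) : nat := (trunc_log 2 (Num.truncn (y + 2))).-1.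

Lemma log2_degP y : 0 <= y ->
  2 ^+ (log2_deg y).+1 <= y + 2 < 2 ^+ (log2_deg y).+2.
Proof.
move=> y0; have y20 : 0 <= y + 2 by lra.
have t2 : (2 <= Num.truncn (y + 2))%N by rewrite truncn_ge_nat// lerDr.
have /andP[] := @trunc_log_bounds 2 (Num.truncn (y + 2)) isT (ltnW t2).
have l0 : (0 < trunc_log 2 (Num.truncn (y + 2)))%N by rewrite trunc_log_gt0 t2.
rewrite /log2_deg prednK// truncn_ge_nat// truncn_lt_nat// !natrX.
by move=> -> ->.
Qed.

(* 2 ^ (k + 1) - 2 is the total weight of a block with k zeros; the run at
   (j + 1) ^ 2 is the longest one that keeps the sum of the weights below Phi. *)
Fixpoint greedy_sum Phi j : R :=
  if j is i.+1 then
    greedy_sum Phi i +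
    (2 ^ (minn i (log2_deg (Phi (i.+1 ^ 2)%N - greedy_sum Phi i))).+1 - 2)%N%:R
  else 0.

Definition greedy_deg Phi j := log2_deg (Phi (j.+1 ^ 2)%N - greedy_sum Phi j).

(** The cap [j] keeps the block length at most 2j + 2, below the gap 2j + 3 between the squares; it
    is eventually inactive. *)
Definition greedy_run Phi j := minn j (greedy_deg Phi j).

Lemma greedy_sumE Phi j :
  greedy_sum Phi j = (\sum_(i < j) (2 ^ (greedy_run Phi i).+1 - 2))%N%:R.
Proof. by elim: j => [|j IHj]; rewrite ?big_ord0// big_ord_recr natrD -IHj. Qed.

Variables (Phi : nat -> R).
Hypothesis Phi_ge0 : forall n, 0 <= Phi n.
Hypothesis Phi_le : {homo Phi : m n / (m <= n)%N >-> m <= n}.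

Let Phi_sqS j : Phi (j.+1 ^ 2)%N <= Phi (j.+2 ^ 2)%N.
Proof. by apply: Phi_le; rewrite leq_exp2r. Qed.

Lemma greedy_sum_ge0 j : 0 <= greedy_sum Phi j.
Proof. by rewrite greedy_sumE. Qed.

Lemma greedy_sumS j : greedy_sum Phi j.+1 =
  greedy_sum Phi j + 2 ^+ (greedy_run Phi j).+1 - 2.
Proof.
by rewrite /= natrB ?natrX ?addrA// expnS leq_pmulr ?expn_gt0.
Qed.

(** The first half makes the defect nonnegative, as [log2_degP] requires; monotonicity of [Phi]
    turns the second half into the first half for [j.+1]. *)
Lemma greedy_sum_le j : greedy_sum Phi j <= Phi (j.+1 ^ 2)%N /\
  greedy_sum Phi j.+1 <= Phi (j.+1 ^ 2)%N.
Proof.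
have step i : greedy_sum Phi i <= Phi (i.+1 ^ 2)%N ->
    greedy_sum Phi i.+1 <= Phi (i.+1 ^ 2)%N.
  rewrite -subr_ge0 => /log2_degP/andP[].
  rewrite -/(greedy_deg Phi i) greedy_sumS => + _.
  suff : 2 ^+ (greedy_run Phi i).+1 <= 2 ^+ (greedy_deg Phi i).+1 :> R by lra.
  by rewrite ler_weXn2l ?ler1n// ltnS geq_minr.
elim: j => [|j [_ IHj]]; first by split; [|apply: step]; exact: Phi_ge0.
have Dj := le_trans IHj (Phi_sqS j).
by split=> //; exact: step.
Qed.

Section growth.
Variable gamma : R.
Hypothesis gamma_itv : 0 <= gamma < 1 / 2.
Variable B : R.
Hypothesis Phi_growth : \forall n \near \oo, Phi n <= B * 2 `^ (n%:R `^ gamma).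

(** The defect is at most [Phi] at the square of j+1, that is B times 2^((j+1)^(2 gamma)), so the
    degree is O(j^(2 gamma)) with 2 gamma < 1. *)
Lemma near_greedy_deg M :
  \forall j \near \oo, (M * (greedy_deg Phi j).*2.+2 <= j.+1)%N.
Proof.
have jS j : (j <= j.+1)%N by [].
have jSS j : (j <= j.+1 ^ 2)%N by rewrite ltnW// expnS leq_pmulr.
have gamma2 : 0 <= gamma * 2 < 1 by have := gamma_itv; lra.
pose K := Num.truncn (B + 2).
near=> j.
have BPhi : Phi (j.+1 ^ 2)%N <= B * 2 `^ ((j.+1 ^ 2)%:R `^ gamma).
  by near: j; exact: (near_infty_comp jSS Phi_growth).
have powj : M%:R *+ 2 * (K.+1%:R) * (j.+1%:R `^ (gamma * 2) + 1) <= j.+1%:R.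
  by near: j; apply: (near_infty_comp jS (near_powR_le _ gamma2)).
have jE : (j.+1 ^ 2)%:R `^ gamma = j.+1%:R `^ (gamma * 2) :> R.
  by rewrite natrX -powR_mulrn// -powRrM mulrC.
move: BPhi powj; rewrite jE; set y := _ `^ (gamma * 2) => BPhi powj.
have y0 : 0 <= y by exact: powR_ge0.
have [Dj _] := greedy_sum_le j; rewrite -subr_ge0 in Dj.
have /andP[deg _] := log2_degP Dj.
have D0 := greedy_sum_ge0 j.
have y1 : 1 <= 2 `^ y :> R by rewrite -[leLHS](powRr0 2) ler_powR// ler1n.
have degK : 2 ^+ (greedy_deg Phi j).+1 <= 2 `^ (y + K.+1%:R) :> R.
  apply: (le_trans deg); apply: (@le_trans _ _ ((B + 2) * 2 `^ y)); first lra.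
  rewrite powRD ?pnatr_eq0 ?implybT// mulrC ler_wpM2l ?powR_ge0//.
  apply: (@le_trans _ _ K.+1%:R); first by rewrite ltW// truncnS_gt.
  by rewrite powR_mulrn// -natrX ler_nat ltnW// ltn_expl.
have {degK} : (greedy_deg Phi j).+1%:R <= y + K.+1%:R :> R.
  rewrite leNgt; apply/negP => lt_deg; move: degK.
  rewrite -powR_mulrn// leNgt => /negP; apply.
  by rewrite /powR pnatr_eq0/= ltr_expR ltr_pM2r// ln_gt0// ltr1n.
move=> degK; rewrite -(ler_nat R) natrM (le_trans _ powj)//.
rewrite -doubleS -muln2 natrM.
have : (greedy_deg Phi j).+1%:R <= K.+1%:R * (y + 1).
  by apply: (le_trans degK); rewrite mulrDr mulr1 lerD2r ler_peMl// ler1n.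
by move=> /(ler_wpM2l (ler0n _ M)); lra.
Unshelve. all: by end_near. Qed.

Lemma near_greedy_run : \forall j \near \oo, greedy_run Phi j = greedy_deg Phi j.
Proof.
have [J _ JP] := near_greedy_deg 1; exists J => // j /JP /=.
by rewrite /greedy_run => ?; apply/minn_idPr; lia.
Qed.

Hypothesis Phi_cvg : (Phi n)^-1 @[n --> \oo] --> (0 : R).
Hypothesis Phi_gt0 : \forall n \near \oo, 0 < Phi n.
Hypothesis Phi_ratio :
  (Phi (j.+1 ^ 2)%N / Phi (j.+2 ^ 2)%N) @[j --> \oo] --> (1 : R).

Lemma cvg_greedy_sum :
  (greedy_sum Phi j.+1 / Phi (j.+1 ^ 2)%N) @[j --> \oo] --> (1 : R).
Proof.
pose rho j := 1 - greedy_sum Phi j.+1 / Phi (j.+1 ^ 2)%N.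
(* [rho] is the relative defect; [delta] collects the growth of [Phi] between squares and the 2
   subtracted in each block weight. *)
pose delta j := 1 - Phi (j.+1 ^ 2)%N / Phi (j.+2 ^ 2)%N + 2 / Phi (j.+2 ^ 2)%N.
have rho0 j : 0 <= rho j.
  rewrite subr_ge0; have [_ le_Phi] := greedy_sum_le j.
  have := Phi_ge0 (j.+1 ^ 2)%N; rewrite le_eqVlt => /predU1P[<-|Phi0].
    by rewrite invr0 mulr0.
  by rewrite ler_pdivrMr// mul1r.
have jSS j : (j <= j.+1 ^ 2)%N by rewrite ltnW// expnS leq_pmulr.
have jSSS j : (j <= j.+2 ^ 2)%N by rewrite (leq_trans (ltnW (leqnSn j.+1)))// expnS
  leq_pmulr.
have jS j : (j <= j.+1)%N by [].
suff : rho @ \oo --> 0.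
  move=> rho_cvg; rewrite -[X in _ --> X]subr0.
  have -> : (fun j => greedy_sum Phi j.+1 / Phi (j.+1 ^ 2)%N) = (fun j => 1 - rho j).
    by apply/funext => j; rewrite /rho opprB addrC subrK.
  by apply: cvgB => //; exact: cvg_cst.
apply: (@cvg0_halving rho delta) => //.
- near=> j.
  have Phi1 : 0 < Phi (j.+1 ^ 2)%N by near: j; exact: (near_infty_comp jSS Phi_gt0).
  have Phi2 : 0 < Phi (j.+2 ^ 2)%N by near: j; exact: (near_infty_comp jSSS Phi_gt0).
  have run : greedy_run Phi j.+1 = greedy_deg Phi j.+1.
    by near: j; exact: (near_infty_comp jS near_greedy_run).
  have [Dj _] := greedy_sum_le j.+1; rewrite -subr_ge0 in Dj.
  have /andP[_ deg] := log2_degP Dj.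
  move: deg; rewrite -/(greedy_deg Phi j.+1) -run exprS => deg.
  (* By maximality of the run the new weight exceeds D/2 - 1, where D is the defect before the
     block; what remains is less than (D + 2)/2. *)
  have Dle : 1 - greedy_sum Phi j.+2 / Phi (j.+2 ^ 2)%N <=
      (1 - greedy_sum Phi j.+1 / Phi (j.+2 ^ 2)%N + 2 / Phi (j.+2 ^ 2)%N) / 2.
    have := greedy_sumS j.+1; move: deg Phi2; move: (Phi _) (2 ^+ _).
    move: (greedy_sum Phi j.+2) (greedy_sum Phi j.+1) => D2 D1 P p deg P0 D2E.
    have Pi := divff (lt0r_neq0 P0); have i0 : 0 <= P^-1 by rewrite invr_ge0 ltW.
    by move: (P^-1) Pi i0 => i Pi i0; have := ler_wpM2r i0 (ltW deg); rewrite D2E; lra.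
  apply: (le_trans Dle); rewrite ler_pM2r ?invr_gt0// /delta.
  have Drho : greedy_sum Phi j.+1 / Phi (j.+2 ^ 2)%N =
      (1 - rho j) * (Phi (j.+1 ^ 2)%N / Phi (j.+2 ^ 2)%N).
    by rewrite /rho opprB addrC subrK mulrA divfK ?gt_eqF.
  rewrite Drho.
  have : Phi (j.+1 ^ 2)%N / Phi (j.+2 ^ 2)%N <= 1.
    by rewrite ler_pdivrMr// mul1r Phi_sqS.
  move=> /(ler_wpM2l (rho0 j)); rewrite mulr1; set q := Phi _ / Phi _.
  lra.
- rewrite -[X in _ --> X]addr0; apply: cvgD.
    by rewrite -[X in _ --> X](subrr 1); apply: cvgB => //; exact: cvg_cst.
  rewrite -[X in _ --> X](mulr0 2); apply: cvgMl_tmp.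
  apply/cvgrPdist_le => e e0.
  apply: (@near_infty_comp _ (fun n => `|0 - (Phi n)^-1| <= e) jSSS).
  by move/cvgrPdist_le : Phi_cvg; apply.
Unshelve. all: by end_near. Qed.

End growth.
End greedy.

(** * Level sets for finite positive beta *)

Section positive_level.
Context {R : realType}.
Variables (Psi : nat -> R) (beta gamma : R).
Hypothesis beta_gt0 : 0 < beta.
Hypothesis gamma_itv : 0 <= gamma < 1 / 2.
Hypothesis Psi_ge0 : forall n, 0 <= Psi n.
Hypothesis Psi_le : {homo Psi : m n / (m <= n)%N >-> m <= n}.
Hypothesis Psi_gt0 : \forall n \near \oo, 0 < Psi n.
Hypothesis Psi_growth : \forall n \near \oo, Psi n <= 2 `^ (n%:R `^ gamma).
Hypothesis Psi_superlinear : (n%:R / Psi n) @[n --> \oo] --> (0 : R).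
Hypothesis Psi_ratio :
  (Psi (j.+1 ^ 2)%N / Psi (j.+2 ^ 2)%N) @[j --> \oo] --> (1 : R).

Let Phi n := beta * Psi n.
Let b j := (j.+1 ^ 2)%N.
Let k := greedy_run Phi.

Let Phi_ge0 n : 0 <= Phi n.
Proof. by rewrite mulr_ge0 ?(ltW beta_gt0). Qed.

Let Phi_le : {homo Phi : m n / (m <= n)%N >-> m <= n}.
Proof. by move=> m n mn; rewrite ler_pM2l// Psi_le. Qed.

Let Phi_gt0 : \forall n \near \oo, 0 < Phi n.
Proof. by apply: filterS Psi_gt0 => n Psin; rewrite mulr_gt0. Qed.

Let Phi_growth : \forall n \near \oo, Phi n <= beta * 2 `^ (n%:R `^ gamma).
Proof. by apply: filterS Psi_growth => n Psin; rewrite ler_pM2l. Qed.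

Let Phi_ratio : (Phi (b j) / Phi (b j.+1)) @[j --> \oo] --> (1 : R).
Proof.
under eq_fun do rewrite /Phi -mulf_div divff ?gt_eqF// mul1r.
exact: Psi_ratio.
Qed.

Let Phi_cvg : (Phi n)^-1 @[n --> \oo] --> (0 : R).
Proof.
apply: (@squeeze_cvgr _ _ _ _ (fun=> 0) (fun n => beta^-1 * (n%:R / Psi n))).
- near=> n; rewrite invr_ge0 Phi_ge0/= invfM ler_pM2l ?invr_gt0// ler_peMl ?invr_ge0//.
  by rewrite ler1n; near: n; exact: nbhs_infty_gt.
- exact: cvg_cst.
- by rewrite -[X in _ --> X](mulr0 beta^-1); apply: cvgMl_tmp.
Unshelve. all: by end_near. Qed.

Let block_gap j : (b j + (k j).*2.+2 <= b j.+1)%N.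
Proof.
rewrite /b -(addn1 j.+1) sqrnD muln1 exp1n -addnA leq_add2l.
by have := geq_minl j (greedy_deg Phi j); rewrite -/(greedy_run Phi j) -/(k j); lia.
Qed.

Lemma near_weight_sum_greedy eps : 0 < eps < 1 ->
  \forall n \near \oo, (1 - eps) * Phi n <= (weight_sum b k n)%:R <= Phi n.
Proof.
move=> /andP[eps0 eps1]; apply: (near_infty_blocks block_gap).
(* Three factors 1 - eps/3 are lost, two for steps between consecutive squares and one for the
   greedy sum; their product is at least 1 - eps. *)
have eps30 : 0 < eps / 3 by rewrite divr_gt0.
have [J1 _ J1P] : \forall j \near \oo, Phi (b j) / Phi (b j.+1) >= 1 - eps / 3.
  have /cvgrPdist_le/(_ _ eps30) := Phi_ratio; apply: filterS => j.
  by rewrite ler_norml => ?; lra.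
have [J2 _ J2P] : \forall j \near \oo,
    greedy_sum Phi j.+1 / Phi (b j) >= 1 - eps / 3.
  have /cvgrPdist_le/(_ _ eps30) := cvg_greedy_sum Phi_ge0 Phi_le gamma_itv
    Phi_growth Phi_cvg Phi_gt0 Phi_ratio.
  by apply: filterS => j; rewrite ler_norml => ?; lra.
have [J3 _ J3P] := Phi_gt0.
have JbJ j : (j <= b j)%N by rewrite ltnW// /b expnS leq_pmulr.
exists (maxn J1 (maxn J2 J3)).+1 => // -[//|j] /= Jj n /andP[jn nj].
have J1j : (J1 <= j)%N by lia.
have J2j : (J2 <= j)%N by lia.
have J3j : (J3 <= j)%N by lia.
have P0 : 0 < Phi (b j) by apply: J3P => /=; apply: leq_trans (JbJ j).
have P01 : Phi (b j) <= Phi (b j.+1) by apply: Phi_le; rewrite leq_exp2r.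
have P12 : Phi (b j.+1) <= Phi (b j.+2) by apply: Phi_le; rewrite leq_exp2r.
have := J1P _ J1j; rewrite /= ler_pdivlMr ?(lt_le_trans P0)// => r1.
have := J1P _ (leqW J1j); rewrite /= ler_pdivlMr => [r2|]; last first.
  by rewrite (lt_le_trans P0)// (le_trans P01).
have := J2P _ J2j; rewrite /= ler_pdivlMr// => r3.
have wlo : greedy_sum Phi j.+1 <= (weight_sum b k n)%:R.
  rewrite greedy_sumE -(weight_sum_block block_gap) ler_nat.
  exact: leq_weight_sum.
have whi : (weight_sum b k n)%:R <= greedy_sum Phi j.+2.
  rewrite greedy_sumE -(weight_sum_block block_gap) ler_nat.
  by apply: leq_weight_sum; rewrite ltnW.
have Pn1 : Phi n <= Phi (b j.+2) by apply: Phi_le; rewrite ltnW.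
have Pn0 : Phi (b j.+1) <= Phi n by exact: Phi_le.
have [_ Dj] := greedy_sum_le Phi_ge0 Phi_le j.+1.
apply/andP; split; last by rewrite (le_trans whi)// (le_trans Dj).
apply: le_trans wlo; apply: le_trans r3.
have Pn : 0 <= Phi n by exact: Phi_ge0.
have : eps = eps / 3 * 3 by rewrite divfK.
move: (eps / 3) eps30 r1 r2 => t t0 r1 r2 epsE; have a0 : 0 <= 1 - t by lra.
apply: le_trans (ler_wpM2l a0 r1); rewrite [leRHS]mulrA.
have aa0 := mulr_ge0 a0 a0.
apply: le_trans (ler_wpM2l aa0 r2); rewrite [leRHS]mulrA.
have aaa0 := mulr_ge0 aa0 a0.
apply: le_trans (ler_wpM2l aaa0 Pn1); rewrite ler_wpM2r//.
have t20 : 0 <= t * t by rewrite mulr_ge0 ?(ltW t0).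
by have := mulr_ge0 t20 a0; lra.
Qed.

Lemma cvg_weight_sum_greedy :
  ((weight_sum b k n)%:R / Psi n) @[n --> \oo] --> beta.
Proof.
apply/cvgrPdist_le => e e0.
pose eps := Num.min (1 / 2) (e / beta).
have eps01 : 0 < eps < 1.
  by rewrite lt_min gt_min divr_gt0// divr_gt0//=; apply/orP; left; lra.
have eps_e : eps * beta <= e.
  by rewrite -ler_pdivlMr// ge_min lexx orbT.
near=> n.
have Psin : 0 < Psi n by near: n.
have : (1 - eps) * Phi n <= (weight_sum b k n)%:R <= Phi n.
  by near: n; exact: near_weight_sum_greedy.
rewrite /Phi mulrA => /andP[w1 w2].
rewrite -ler_pdivlMr// in w1; rewrite -ler_pdivrMr// in w2.
by rewrite ler_norml; lra.
Unshelve. all: by end_near. Qed.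

Lemma hausdorff_dim_level_set_pos : hausdorff_dim (level_set Psi beta%:E) = 1%E.
Proof.
apply: (hausdorff_dim_block_sequences block_gap).
- move=> M; have [J _ JP] := near_greedy_deg Phi_ge0 Phi_le gamma_itv Phi_growth M.
  exists J => j Jj; apply: (@leq_trans (M * (greedy_deg Phi j.+1).*2.+2)).
    by rewrite leq_mul2l !ltnS leq_double geq_minr orbT.
  apply: (leq_trans (JP _ (leqW Jj))); rewrite /b -(addn1 j.+1) sqrnD muln1.
  by rewrite exp1n -addnA addKn; lia.
- exact: level_set_sub_unit.
move=> x C x01 xC; apply/level_setP; split=> //.
apply: (@squeeze_cvgr _ _ _ _ (fun n => (weight_sum b k n)%:R / Psi n)
  (fun n => (weight_sum b k n)%:R / Psi n + C * (n%:R / Psi n))).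
- near=> n; have := xC n; rewrite mulrA -mulrDl => /andP[S1 S2].
  by rewrite !ler_wpM2r// invr_ge0.
- exact: cvg_weight_sum_greedy.
rewrite -[X in _ --> X]addr0; apply: cvgD; first exact: cvg_weight_sum_greedy.
by rewrite -[X in _ --> X](mulr0 C); apply: cvgMl_tmp.
Unshelve. all: by end_near. Qed.
End positive_level.

(** * Growth and regularity of the three kinds of rates *)

Section growth_rates.
Context {R : realType}.
Implicit Types (Psi : nat -> R) (A a gamma : R).

Definition stretched_exp gamma (n : nat) : R := 2 `^ (n%:R `^ gamma).

Lemma stretched_exp_gt0 gamma n : 0 < stretched_exp gamma n.
Proof. exact: powR_gt0. Qed.

Lemma stretched_exp_le gamma : 0 <= gamma ->
  {homo stretched_exp gamma : m n / (m <= n)%N >-> m <= n}.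
Proof.
move=> gamma0 m n mn; rewrite ler_powR ?ler1n//.
by rewrite ge0_ler_powR ?nnegrE// ler_nat.
Qed.

Lemma near_powR_le_stretched_exp a gamma : 0 < gamma ->
  \forall n \near \oo, n%:R `^ a <= stretched_exp gamma n.
Proof.
move=> gamma0; near=> n.
have n0 : 0 < n%:R :> R by rewrite ltr0n; near: n; exact: nbhs_infty_gt.
have ln2 : 0 < ln 2 :> R by rewrite ln_gt0// ltr1n.
have : a / ln 2 * ln n%:R <= n%:R `^ gamma by near: n; exact: near_ln_le_powR.
rewrite mulrAC ler_pdivrMr// /stretched_exp => h.
by rewrite {1}/powR gt_eqF// /powR pnatr_eq0/= -/(powR _ _) ler_expR.
Unshelve. all: by end_near. Qed.

Lemma cvg_superlinear Psi :
  (forall A, \forall n \near \oo, A * n%:R <= Psi n) ->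
  (n%:R / Psi n) @[n --> \oo] --> (0 : R).
Proof.
move=> Psi_ge; apply/cvgrPdist_le => e e0; near=> n.
have n0 : 0 < n%:R :> R by rewrite ltr0n; near: n; exact: nbhs_infty_gt.
have nPsi : e^-1 * n%:R <= Psi n by near: n.
have Psi0 : 0 < Psi n by apply: lt_le_trans nPsi; rewrite mulr_gt0// invr_gt0.
rewrite sub0r normrN ger0_norm; last by rewrite divr_ge0// ltW.
by rewrite ler_pdivrMr// -ler_pdivrMl.
Unshelve. all: by end_near. Qed.

Lemma near_powR_superlinear A a : 1 < a ->
  \forall n \near \oo, A * n%:R <= n%:R `^ a :> R.
Proof.
move=> a1; have a10 : 0 < a - 1 by rewrite subr_gt0.
near=> n; have An : A <= n%:R `^ (a - 1) by near: n; exact: near_powR_ge.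
by rewrite -mulr_powRB1 ?(lt_trans ltr01)// mulrC ler_wpM2l.
Unshelve. all: by end_near. Qed.

Lemma near_ln_superlinear A : \forall n \near \oo, A * n%:R <= n%:R * ln n%:R :> R.
Proof.
near=> n; rewrite mulrC ler_wpM2l// -[A]expRK ler_ln ?posrE ?expR_gt0//.
  by near: n; exact: nbhs_infty_ger.
by rewrite ltr0n; near: n; exact: nbhs_infty_gt.
Unshelve. all: by end_near. Qed.

Lemma near_stretched_exp_superlinear A gamma : 0 < gamma ->
  \forall n \near \oo, A * n%:R <= stretched_exp gamma n.
Proof.
move=> gamma0; near=> n; apply: (@le_trans _ _ (n%:R `^ 2)).
  by near: n; apply: near_powR_superlinear; rewrite ltr1n.
by near: n; exact: near_powR_le_stretched_exp.
Unshelve. all: by end_near. Qed.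

Lemma powR_succ_le (m : nat) a : (0 < m)%N -> 0 <= a <= 1 ->
  m.+1%:R `^ a <= m%:R `^ a + m%:R `^ (a - 1).
Proof.
move=> m0 /andP[a0 a1]; have mR : 0 < m%:R :> R by rewrite ltr0n.
have -> : m.+1%:R = m%:R * (1 + m%:R^-1) :> R.
  by rewrite mulrDr mulr1 divff ?gt_eqF// natr1.
rewrite powRM ?addr_ge0 ?invr_ge0//.
have -> : m%:R `^ (a - 1) = m%:R `^ a * m%:R^-1.
  by rewrite powRD ?(gt_eqF mR) ?implybT// powR_inv1.
by rewrite -[X in _ <= X + _]mulr1 -mulrDr ler_wpM2l ?powR_ge0// ler1_powR// lerDl
  invr_ge0.
Qed.

Lemma powR_succ_ge (m : nat) a : (0 < m)%N -> 1 <= a ->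
  m%:R `^ a + 1 <= m.+1%:R `^ a.
Proof.
move=> m0 a1; have a0 : 0 < a by apply: lt_le_trans a1.
have m1 : 1 <= m%:R `^ (a - 1) :> R.
  by rewrite -[leLHS](powRr0 m%:R) ler_powR ?ler1n// subr_ge0.
rewrite -(@mulr_powRB1 _ m.+1%:R)// -(@mulr_powRB1 _ m%:R)//.
have : m%:R `^ (a - 1) <= m.+1%:R `^ (a - 1) :> R.
  by rewrite ge0_ler_powR ?nnegrE ?subr_ge0// ler_nat.
rewrite -(natr1 m) mulrDl mul1r; move: (_ `^ _) (_ `^ _) m1 => u v u1 uv.
have := ler_wpM2l (ler0n R m) uv; lra.
Qed.

Lemma stretched_exp_double (m : nat) gamma : (0 < m)%N -> 1 <= gamma ->
  2 * stretched_exp gamma m <= stretched_exp gamma m.+1.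
Proof.
move=> m0 gamma1; rewrite /stretched_exp -{1}(@powRr1 _ 2)//.
rewrite -powRD ?pnatr_eq0 ?implybT//.
by rewrite ler_powR ?ler1n// addrC powR_succ_ge.
Qed.

Lemma stretched_exp_ge_pow (m : nat) gamma : (0 < m)%N -> 1 <= gamma ->
  2 ^+ m <= stretched_exp gamma m.
Proof.
move=> m0 gamma1; rewrite -powR_mulrn// ler_powR ?ler1n//.
by rewrite -{1}[m%:R]powRr1// ler_powR// ler1n.
Qed.

(** Source of the critical exponent 1/2: along squares [gamma] becomes 2 gamma, and consecutive
    ratios tend to 1 below exponent 1, whereas the values at least double from 1 on. *)
Lemma stretched_exp_sqr (m : nat) gamma :
  stretched_exp gamma (m ^ 2)%N = stretched_exp (gamma * 2) m.
Proof. by rewrite /stretched_exp natrX -powR_mulrn// -powRrM mulrC. Qed.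

Lemma cvg_powRN a : 0 < a -> (n%:R `^ (- a)) @[n --> \oo] --> (0 : R).
Proof.
move=> a0; apply/cvgrPdist_le => e e0; near=> n.
have en : e^-1 <= n%:R `^ a by near: n; exact: near_powR_ge.
rewrite sub0r normrN ger0_norm ?powR_ge0// powRN invf_ple ?posrE//.
by apply: lt_le_trans en; rewrite invr_gt0.
Unshelve. all: by end_near. Qed.

(** Squeeze between 1 - c and 1; ratios of rates are written as exponentials of increments. *)
Lemma cvg_expR_ratio (u c : nat -> R) :
  (\forall j \near \oo, 0 <= u j <= c j) -> c @ \oo --> 0 ->
  expR (- u j) @[j --> \oo] --> (1 : R).
Proof.
move=> uc c0; apply: (@squeeze_cvgr _ _ _ _ (fun j => 1 - c j) (fun=> 1)).
- apply: filterS uc => j /andP[u0 uc]; apply/andP; split.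
    by apply: le_trans (expR_ge1Dx _); rewrite lerD2l lerN2.
  by rewrite -[leRHS]expR0 ler_expR oppr_le0.
- by rewrite -[X in _ --> X]subr0; apply: cvgB => //; exact: cvg_cst.
- exact: cvg_cst.
Qed.

Lemma cvg_stretched_exp_ratio gamma : 0 <= gamma < 1 ->
  (stretched_exp gamma n / stretched_exp gamma n.+1) @[n --> \oo] --> (1 : R).
Proof.
move=> /andP[gamma0 gamma1].
have ln2 : 0 < ln 2 :> R by rewrite ln_gt0// ltr1n.
pose u n : R := (n.+1%:R `^ gamma - n%:R `^ gamma) * ln 2.
have -> : (fun n => stretched_exp gamma n / stretched_exp gamma n.+1) =
    (fun n => expR (- u n)).
  apply/funext => n; rewrite /u -mulNr opprB mulrBl expRB.
  by rewrite /stretched_exp /powR pnatr_eq0.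
apply: (@cvg_expR_ratio _ (fun n => n%:R `^ (- (1 - gamma)) * ln 2)).
  near=> n; rewrite mulr_ge0 ?(ltW ln2)//=; last first.
    by rewrite subr_ge0 ge0_ler_powR ?nnegrE// ler_nat.
  rewrite ler_wpM2r ?(ltW ln2)// lerBlDl opprB powR_succ_le ?gamma0 ?(ltW gamma1)//.
  by near: n; exact: nbhs_infty_gt.
by rewrite -[X in _ --> X](mul0r (ln 2)); apply: cvgMr_tmp; apply: cvg_powRN;
  rewrite subr_gt0.
Unshelve. all: by end_near. Qed.

Lemma cvg_stretched_exp_sqr_ratio gamma : 0 <= gamma < 1 / 2 ->
  (stretched_exp gamma (j.+1 ^ 2)%N / stretched_exp gamma (j.+2 ^ 2)%N)
    @[j --> \oo] --> (1 : R).
Proof.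
move=> gamma12.
under eq_fun do rewrite !stretched_exp_sqr.
have := @cvg_stretched_exp_ratio (gamma * 2); rewrite -cvg_shiftS; apply; lra.
Qed.

Lemma ln_succ_le (m : nat) : (0 < m)%N ->
  ln m%:R <= ln (m.+1%:R : R) <= ln m%:R + m%:R^-1.
Proof.
move=> m0; have mR : 0 < m%:R :> R by rewrite ltr0n.
rewrite ler_ln ?posrE// ler_nat leqnSn/=.
have -> : m.+1%:R = m%:R * (1 + m%:R^-1) :> R.
  by rewrite mulrDr mulr1 divff ?gt_eqF// natr1.
have i0 : 0 < m%:R^-1 :> R by rewrite invr_gt0.
by rewrite lnM ?posrE ?addr_gt0// lerD2l le_ln1Dx// (lt_trans _ i0)// ltrN10.
Qed.

Lemma cvg_powR_sqr_ratio a : 0 <= a ->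
  ((j.+1 ^ 2)%:R `^ a / (j.+2 ^ 2)%:R `^ a) @[j --> \oo] --> (1 : R).
Proof.
move=> a0; pose u j : R := (ln j.+2%:R - ln j.+1%:R) * (2 * a).
have -> : (fun j => (j.+1 ^ 2)%:R `^ a / (j.+2 ^ 2)%:R `^ a) = (fun j => expR (- u j)).
  apply/funext => j; rewrite /powR !pnatr_eq0 /= -expRB !natrX !lnXn//.
  by congr expR; rewrite /u; lra.
have a20 : 0 <= 2 * a by rewrite mulr_ge0.
apply: (@cvg_expR_ratio _ (fun j => j.+1%:R^-1 * (2 * a))).
  apply: nearW => j; have /andP[l1 l2] := @ln_succ_le j.+1 isT.
  by rewrite mulr_ge0 ?subr_ge0//= ler_wpM2r// lerBlDl.
rewrite -[X in _ --> X](mul0r (2 * a)); apply: cvgMr_tmp; exact: cvg_harmonic.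
Qed.

Lemma cvg_ln_sqr_ratio :
  (ln (j.+1 ^ 2)%:R / ln (j.+2 ^ 2)%:R) @[j --> \oo] --> (1 : R).
Proof.
have ln_cvg : (1 - (ln j.+2%:R)^-1) @[j --> \oo] --> (1 : R).
  rewrite -[X in _ --> X]subr0; apply: cvgB; first exact: cvg_cst.
  (* 1 / ln n is n / (n ln n), shifted here by two indices. *)
  have := @cvg_superlinear (fun n => n%:R * ln n%:R) near_ln_superlinear.
  rewrite -cvg_shiftS -cvg_shiftS; apply: cvg_trans; apply: near_eq_cvg.
  by apply: nearW => n /=; rewrite invfM mulrA divff ?pnatr_eq0// mul1r.
apply: squeeze_cvgr ln_cvg (cvg_cst _); apply: nearW => j.
have /andP[l1 l2] := @ln_succ_le j.+1 isT.
have l0 : 0 < ln j.+2%:R :> R by rewrite ln_gt0// ltr1n.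
have j1 : j.+1%:R^-1 <= 1 :> R by rewrite invf_le1// ler1n.
have -> : ln (j.+1 ^ 2)%:R / ln (j.+2 ^ 2)%:R = ln j.+1%:R / ln j.+2%:R :> R.
  rewrite !natrX !lnXn// -(mulr_natr (ln j.+1%:R)) -(mulr_natr (ln j.+2%:R)) -mulf_div.
  by rewrite divff ?mulr1.
rewrite ler_pdivlMr// ler_pdivrMr// mulrBl !mul1r mulVf ?gt_eqF// l1 andbT.
by rewrite lerBlDr (le_trans l2)// lerD2l.
Qed.

End growth_rates.

(** * Emptiness of level sets for fast rates *)

Section empty_levels.
Context {R : realType}.
Implicit Types (x M : R) (gamma beta : R).

Local Notation S n x := (birkhoff_sum (@doubling R) (fun y => y^-1) n x).
Local Notation a x i := (iter i (@doubling R) x)^-1.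

Lemma birkhoff_sumD x n l : S (n + l)%N x = S n x + \sum_(j < l) a x (n + j)%N.
Proof. by rewrite /birkhoff_sum big_split_ord. Qed.

Section orbit.
Variable x : R.
Hypothesis x01 : 0 < x <= 1.

Lemma inv_orbit_gt0 i : 0 < a x i.
Proof. by rewrite invr_gt0; case/andP: (iter_doubling_itv i x01). Qed.

(** While the inverse is at least 2, the point is at most 1/2 and the map doubles it exactly. *)
Lemma inv_orbit_halving i l : 2 ^+ l <= a x i -> a x (i + l)%N = a x i / 2 ^+ l.
Proof.
elim: l => [|l IHl] il; first by rewrite addn0 expr0 divr1.
have il' : 2 ^+ l <= a x i by apply: le_trans il; rewrite ler_weXn2l ?ler1n.
have /andP[t0 t1] := iter_doubling_itv (i + l) x01.
have := IHl il'; rewrite addnS iterS doublingE ?t0// => al.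
have al2 : 2 <= a x (i + l)%N by rewrite al ler_pdivlMr ?exprn_gt0// -exprS.
have t2 : iter (i + l) (@doubling R) x <= 1 / 2.
  by rewrite mul1r -[leLHS]invrK lef_pV2 ?posrE ?invr_gt0.
by rewrite ltNge t2/= subr0 -(mulr_natl (iter _ _ _)) invfM al exprS invfM mulrCA.
Qed.

Lemma sum_halving (c : R) l : \sum_(j < l) c / 2 ^+ j = c *+ 2 - c *+ 2 / 2 ^+ l.
Proof.
elim: l => [|l IHl]; first by rewrite big_ord0 expr0 divr1 subrr.
by rewrite big_ord_recr/= IHl exprS invfM mulr2n; lra.
Qed.

(* A value above 2 ^ L is followed by L successive halvings, so the values above
   2 ^ L in a window of length at most L + 1 contribute at most twice their maximum. *)
Lemma inv_orbit_window M L i l : 0 <= M -> (l <= L.+1)%N ->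
  (forall j, (j < l)%N -> a x (i + j)%N <= M) ->
  \sum_(j < l) a x (i + j)%N <= M *+ 2 + l%:R * 2 ^+ L.
Proof.
move=> M0; elim: l i => [|l IHl] i lL aM.
  by rewrite big_ord0 mul0r addr0 mulrn_wge0.
have [big_i|small_i] := leP (2 ^+ L) (a x i).
  rewrite (eq_bigr (fun j : 'I_l.+1 => a x i / 2 ^+ j)); last first.
    move=> j _; apply: inv_orbit_halving; apply: le_trans big_i.
    by rewrite ler_weXn2l ?ler1n// -ltnS (leq_trans (ltn_ord j)).
  rewrite sum_halving.
  have : a x i <= M by have := aM 0%N (ltn0Sn _); rewrite addn0.
  have a0 := inv_orbit_gt0 i.
  have p0 : 0 <= a x i *+ 2 / 2 ^+ l.+1.
    by rewrite divr_ge0 ?exprn_ge0// mulrn_wge0// ltW.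
  have q0 : 0 <= l.+1%:R * 2 ^+ L :> R by rewrite mulr_ge0 ?exprn_ge0.
  move: (a x i *+ 2 / _) p0 (_ * _ : R) q0 => p p0 q q0; lra.
rewrite big_ord_recl/= addn0.
have := IHl i.+1 (ltnW lL); rewrite -(natr1 l) mulrDl mul1r.
under [X in (_ -> X <= _) -> _]eq_bigr do rewrite addSn.
under [X in _ + X <= _]eq_bigr do rewrite /bump/= add1n addnS.
have h : forall j, (j < l)%N -> a x (i + j).+1 <= M.
  by move=> j jl; rewrite -addnS; apply: aM.
move=> /(_ _) IH; have {IH} : \sum_(j < l) a x (i + j).+1 <= M *+ 2 + l%:R * 2 ^+ L.
  by apply: IH => j jl; rewrite addSn; exact: h.
lra.
Qed.

(** Cut into [c] windows of length at most [L] and apply [inv_orbit_window] to each. *)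
Lemma inv_orbit_windows M L i l (c : nat) : 0 <= M -> (l <= c * L)%N ->
  (forall j, (j < l)%N -> a x (i + j)%N <= M) ->
  \sum_(j < l) a x (i + j)%N <= c%:R * (M *+ 2 + L%:R * 2 ^+ L).
Proof.
move=> M0; elim: c i l => [|c IHc] i l lc aM.
  by move: lc; rewrite mul0n leqn0 => /eqP ->; rewrite big_ord0 mul0r.
have [lL|lL] := leqP l L.
  apply: (le_trans (inv_orbit_window M0 (leqW lL) aM)).
  have : M *+ 2 + l%:R * 2 ^+ L <= M *+ 2 + L%:R * 2 ^+ L.
    by rewrite lerD2l ler_wpM2r ?exprn_ge0// ler_nat.
  move/le_trans; apply; rewrite ler_peMl ?ler1n//.
  by rewrite addr_ge0 ?mulrn_wge0// mulr_ge0// exprn_ge0.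
have [m lE] : exists m, l = (L + m)%N by exists (l - L)%N; lia.
rewrite {l}lE in lc lL aM *.
rewrite big_split_ord/= -(natr1 c) mulrDl mul1r addrC; apply: lerD.
  under eq_bigr do rewrite addnA.
  apply: IHc; first by move: lc; rewrite mulSn leq_add2l.
  by move=> j jm; rewrite -addnA; apply: aM; rewrite ltn_add2l.
by apply: inv_orbit_window => // j jL; apply: aM; exact: ltn_trans jL lL.
Qed.

(** Otherwise the orbit would double forever and leave the unit interval. *)
Lemma orbit_gt_half n : exists2 p, (n <= p)%N & 1 / 2 < iter p (@doubling R) x.
Proof.
apply: contrapT => small.
have t_double l : iter (n + l) (@doubling R) x = iter n (@doubling R) x * 2 ^+ l.
  elim: l => [|l IHl]; first by rewrite addn0 expr0 mulr1.
  rewrite addnS iterS doublingE ?iter_doubling_itv//.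
  case: ltP => [big|_]; first by case: small; exists (n + l)%N => //; rewrite leq_addr.
  by rewrite IHl subr0 exprSr mulrA mulr_natr.
have /andP[t0 _] := iter_doubling_itv n x01.
pose K := Num.truncn (iter n (@doubling R) x)^-1.
have /andP[_] := iter_doubling_itv (n + K.+1) x01; rewrite t_double.
apply/negP; rewrite -ltNge -ltr_pdivrMl// mulr1.
apply: (@lt_le_trans _ _ K.+1%:R); first exact: truncnS_gt.
by rewrite -natrX ler_nat ltnW// ltn_expl.
Qed.

(** A term above 2^(p+1-i) at time i would still be at least 2 at time p, after p - i halvings; the
    resulting bounds form a geometric series. *)
Lemma birkhoff_sum_le_pow p : 1 / 2 < iter p (@doubling R) x -> S p x <= 2 ^+ p.+2.
Proof.
move=> tp; have ap : a x p < 2.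
  by rewrite invf_plt ?posrE//; lra.
have a_le i : (i < p)%N -> a x i <= 2 ^+ p.+1 / 2 ^+ i.
  move=> ip; rewrite leNgt; apply/negP => ai.
  have pE : 2 ^+ p.+1 / 2 ^+ i = 2 * 2 ^+ (p - i) :> R.
    by rewrite -exprS -subSn ?(ltnW ip)// expfB ?leqW// ltnW.
  have := @inv_orbit_halving i (p - i).
  rewrite subnKC ?(ltnW ip)// => halving; move: ap.
  rewrite halving; last first.
    by apply: le_trans (ltW ai); rewrite pE ler_peMl ?exprn_ge0// ler1n.
  apply/negP; rewrite -leNgt ler_pdivlMr ?exprn_gt0//.
  by rewrite -pE ltW.
apply: (@le_trans _ _ (\sum_(i < p) 2 ^+ p.+1 / 2 ^+ i)).
  by apply: ler_sum => i _; exact: a_le.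
rewrite sum_halving -(mulr_natl (2 ^+ p.+1)) -exprS lerBlDr lerDl.
by rewrite divr_ge0 ?exprn_ge0.
Qed.

End orbit.

Lemma dist_ratio_le beta eps s p : 0 < p -> `|beta - s / p| <= eps ->
  (beta - eps) * p <= s <= (beta + eps) * p.
Proof.
move=> p0; rewrite ler_norml => /andP[? ?]; apply/andP; split.
  by rewrite -ler_pdivlMr//; lra.
by rewrite -ler_pdivrMr//; lra.
Qed.

Lemma level_set_stretched_exp_pos_eq0 gamma beta : 1 <= gamma -> 0 < beta ->
  level_set (stretched_exp gamma) beta%:E = set0.
Proof.
move=> gamma1 beta0; apply/seteqP; split=> // x /level_setP[x01 /cvgrPdist_le lim].
have gamma0 : 0 < gamma by apply: lt_le_trans gamma1.
(* Writing P' for the value at p+1, at least twice that at p, the two estimates give 5/6 beta P' <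
   7/12 beta P' + 2, hence beta P' < 8, against the bound 9 chosen next. *)
have beta60 : 0 < beta / 6 by rewrite divr_gt0.
have [N1 _ N1P] := lim _ beta60.
have [N2 _ N2P] := @near_stretched_exp_superlinear R (9 / beta) gamma gamma0.
have [p pN tp] := orbit_gt_half x01 (maxn 1 (maxn N1 N2)).
have p0 : (0 < p)%N by lia.
have /N1P : (N1 <= p)%N by lia.
have /N1P : (N1 <= p.+1)%N by lia.
have /N2P : (N2 <= p.+1)%N by lia.
have Sp : S p.+1 x = S p x + a x p.
  by rewrite -addn1 birkhoff_sumD big_ord1 addn0.
have ap : a x p < 2 by rewrite invf_plt ?posrE//; lra.
have PP := stretched_exp_double p0 gamma1.
have P0 := stretched_exp_gt0 gamma p; have P1 := stretched_exp_gt0 gamma p.+1.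
have p1 : 1 <= p.+1%:R :> R by rewrite ler1n.
rewrite /= Sp => bP /(dist_ratio_le P1)/andP[h1 _] /(dist_ratio_le P0)/andP[_ h2].
have {}bP : 9 <= beta * stretched_exp gamma p.+1.
  rewrite -ler_pdivrMl// mulrC; apply: le_trans bP.
  by rewrite ler_peMr// divr_ge0// ltW.
have := ler_wpM2l (ltW beta0) PP.
move: (stretched_exp gamma p) (stretched_exp gamma p.+1) (S p x) (a x p) ap h1 h2 bP.
by move=> P P' s t *; lra.
Qed.

Lemma level_set_stretched_exp_pinfty_eq0 gamma : 1 <= gamma ->
  level_set (stretched_exp gamma) +oo%E = set0.
Proof.
move=> gamma1; apply/seteqP; split=> // x [x01 /cvgeryP/cvgryPge lim].
(* Any number above 4 works: the sum is at most 2^(p+2), which is at most 4 times the rate at p. *)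
have [N _ NP] := lim 5.
have [p pN tp] := orbit_gt_half x01 N.+1.
have /NP : (N <= p)%N by exact: ltnW.
rewrite /= ler_pdivlMr ?stretched_exp_gt0//.
have p0 : (0 < p)%N by lia.
have pP := stretched_exp_ge_pow p0 gamma1.
have := birkhoff_sum_le_pow x01 tp.
have : 0 < 2 ^+ p :> R by rewrite exprn_gt0.
rewrite !exprS; move: (2 ^+ p) (S p x) (stretched_exp gamma p) pP => u v w uw; lra.
Qed.

Lemma level_set_stretched_exp_mid_eq0 gamma beta : 1 / 2 <= gamma < 1 -> 0 < beta ->
  level_set (stretched_exp gamma) beta%:E = set0.
Proof.
move=> /andP[gamma12 gamma1] beta0; apply/seteqP; split=> // x.
move=> /level_setP[x01 /cvgrPdist_le lim].
have gamma0 : 0 < gamma by lra.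
(* The errors collected below give beta <= (53 + 20 beta) eps, which this choice contradicts. *)
pose eps := beta / (60 + 20 * beta).
have eps0 : 0 < eps by rewrite divr_gt0//; lra.
have epsE : eps * (60 + 20 * beta) = beta by rewrite divfK//; lra.
move: eps eps0 epsE => eps eps0 epsE.
have [N1 _ N1P] := lim _ eps0.
have ratio := @cvg_stretched_exp_ratio R gamma.
have /cvgrPdist_le/(_ _ eps0)[N2 _ N2P] : (stretched_exp gamma n / stretched_exp
  gamma n.+1)
    @[n --> \oo] --> (1 : R) by apply: ratio; rewrite ltW.
(* This provides L^2 <= 2^L for the [L] chosen next. *)
have [N3 _ N3P] := @near_powR_le_stretched_exp R 2 1 ltr01.
pose L := (N1 + N2 + N3 + (Num.truncn eps^-1).+1)%N.
have LN : [/\ (N1 <= L)%N, (N2 <= L)%N, (N3 <= L)%N & (0 < L)%N] by rewrite /L;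
  split; lia.
have L_eps : 1 <= eps * L%:R.
  rewrite -ler_pdivrMl// mulr1 ltW// (lt_le_trans (truncnS_gt _))// ler_nat.
  exact: leq_addl.
case: LN L_eps; move: L => L LN1 LN2 LN3 L0 L_eps.
have [n1 n1E] : exists n1, n1 = (L.*2 ^ 2)%N by eexists.
have [n2 n2E] : exists n2, n2 = (L.*2.+1 ^ 2)%N by eexists.
have n12 : n2 = (n1 + (4 * L).+1)%N.
  by rewrite n2E n1E -(addn1 L.*2) sqrnD muln1 exp1n -addnA; congr (_ + _)%N; lia.
have n1L : (L <= n1)%N.
  rewrite n1E expnS expn1; apply: (@leq_trans L.*2); first by lia.
  by rewrite leq_pmulr// double_gt0.
have gamma2 : 1 <= gamma * 2 by lra.
pose Psi := stretched_exp gamma.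
have P0 : 0 < Psi n2 by exact: stretched_exp_gt0.
have QP : 2 * Psi n1 <= Psi n2.
  rewrite /Psi n1E n2E (stretched_exp_sqr L.*2) (stretched_exp_sqr L.*2.+1).
  by rewrite stretched_exp_double// double_gt0.
(* L 2^L <= eps L^2 2^L <= eps 4^L, and 4^L is below [Psi n2] as 2 gamma >= 1. *)
have L_P : L%:R * 2 ^+ L <= eps * Psi n2.
  have L2 : L%:R * L%:R <= 2 ^+ L :> R.
    have := N3P L LN3; rewrite /= /stretched_exp powRr1// powR_mulrn//.
    by rewrite powR_mulrn// expr2.
  have PL : 2 ^+ L * 2 ^+ L <= Psi n2.
    rewrite -exprD; apply: (@le_trans _ _ (2 ^+ L.*2.+1)).
      by apply: ler_weXn2l; rewrite ?ler1n// addnn leqnSn.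
    by rewrite /Psi n2E stretched_exp_sqr stretched_exp_ge_pow.
  have p0 : 0 <= 2 ^+ L :> R by rewrite exprn_ge0.
  apply: (@le_trans _ _ (eps * (2 ^+ L * 2 ^+ L))); last by rewrite ler_pM2l.
  rewrite mulrA ler_wpM2r//; apply: (@le_trans _ _ (eps * (L%:R * L%:R))).
    by rewrite mulrA ler_peMl.
  by rewrite ler_pM2l.
have eps_small : eps <= beta.
  by rewrite -epsE ler_peMr ?(ltW eps0)//; lra.
have near_beta i : (L <= i)%N ->
    (beta - eps) * Psi i <= S i x <= (beta + eps) * Psi i.
  move=> Li; apply: dist_ratio_le; first exact: stretched_exp_gt0.
  exact: N1P (leq_trans LN1 Li).
have be : 0 <= beta - eps by rewrite subr_ge0.
(* A term is the difference of two consecutive sums, each known up to [eps], and consecutive values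
   of [Psi] differ by a relative error of at most [eps]. *)
have a_small j : (j < (4 * L).+1)%N -> a x (n1 + j)%N <= (2 + beta) * eps * Psi n2.
  move=> jL; set i := (n1 + j)%N.
  have Li : (L <= i)%N by rewrite (leq_trans n1L)// leq_addr.
  have Si : S i.+1 x = S i x + a x i.
    by rewrite -addn1 birkhoff_sumD big_ord1 addn0.
  have /andP[S1 _] := near_beta _ Li.
  have /andP[_] := near_beta _ (leqW Li); rewrite Si => S2.
  have Psi1 : 0 < Psi i.+1 by exact: stretched_exp_gt0.
  have PsiS : (1 - eps) * Psi i.+1 <= Psi i.
    by case/andP: (dist_ratio_le Psi1 (N2P i (leq_trans LN2 Li))).
  have i_n2 : (i.+1 <= n2)%N by rewrite n12 /i ltn_add2l.
  have PsiP : Psi i.+1 <= Psi n2 := stretched_exp_le (ltW gamma0) i_n2.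
  apply: (@le_trans _ _ ((2 + beta) * eps * Psi i.+1)); last first.
    by rewrite ler_wpM2l// mulr_ge0 ?(ltW eps0)// addr_ge0// ltW.
  have := ler_wpM2l be PsiS.
  have := mulr_ge0 (mulr_ge0 (ltW eps0) (ltW eps0)) (ltW Psi1).
  move: (S i x) (a x i) (Psi i) (Psi i.+1) S1 S2 => s t p p' S1 S2.
  by clear -S1 S2; lra.
have M0 : 0 <= (2 + beta) * eps * Psi n2.
  by rewrite !mulr_ge0 ?(ltW eps0) ?(ltW P0)// addr_ge0// ltW.
(* Five windows of length [L] cover the stretch from [n1] to [n2]. *)
have L5 : ((4 * L).+1 <= 5 * L)%N by rewrite -addn1 (mulnDl 4 1 L) mul1n leq_add2l.
have := inv_orbit_windows x01 M0 L5 a_small.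
have := birkhoff_sumD x n1 (4 * L).+1; rewrite -n12 => S12 sum_le.
have /andP[_ S1] := near_beta _ n1L.
have /andP[S2 _] : (beta - eps) * Psi n2 <= S n2 x <= (beta + eps) * Psi n2.
  by apply: near_beta; rewrite n12 (leq_trans n1L)// leq_addr.
have be' : 0 <= beta + eps by rewrite addr_ge0// ltW.
have := mulr_gt0 eps0 P0;
  have : eps * (60 + 20 * beta) * Psi n2 = beta * Psi n2 by rewrite epsE.
have := ler_wpM2l be' QP.
move: (S n1 x) (S n2 x) (\sum_(j < _) _) (_ * 2 ^+ L) S1 S2 S12 sum_le L_P.
move: (Psi n1) (Psi n2) => Q P s1 s2 s l S1 S2 S12 sum_le L_P;
  clear -S1 S2 S12 sum_le L_P.
lra.
Qed.

End empty_levels.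

(** * Full dimension for the concrete rates, and assembly of the regimes *)

Section slow_growth.
Context {R : realType}.
Implicit Types (Psi : nat -> R) (a gamma : R).

Lemma hausdorff_dim_level_set_slow Psi gamma (beta : \bar R) :
  0 < gamma < 1 / 2 ->
  (forall n, 0 <= Psi n) ->
  {homo Psi : m n / (m <= n)%N >-> m <= n} ->
  (\forall n \near \oo, 0 < Psi n) ->
  (\forall n \near \oo, Psi n <= stretched_exp gamma n) ->
  (n%:R / Psi n) @[n --> \oo] --> (0 : R) ->
  (Psi (j.+1 ^ 2)%N / Psi (j.+2 ^ 2)%N) @[j --> \oo] --> (1 : R) ->
  (0 <= beta)%E -> hausdorff_dim (level_set Psi beta) = 1%E.
Proof.
move=> /andP[gamma0 gamma12] Psi0 Psi_le Psi_gt0 Psi_exp Psi_lin Psi_ratio.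
case: beta => [beta| |] //.
  rewrite lee_fin le_eqVlt => /predU1P[<-|beta0].
    exact: hausdorff_dim_level_set0.
  by apply: (@hausdorff_dim_level_set_pos _ _ _ gamma) => //; rewrite ltW.
move=> _; apply: (@hausdorff_dim_level_set_pinfty _ _ gamma).
  by rewrite gamma0/= (lt_trans gamma12)//; lra.
by apply: filterS2 Psi_gt0 Psi_exp => n -> ->.
Qed.

Lemma hausdorff_dim_level_set_nlogn (beta : \bar R) : (0 <= beta)%E ->
  hausdorff_dim (level_set (fun n => n%:R * ln n%:R : R) beta) = 1%E.
Proof.
have ln_ge0n n : 0 <= ln n%:R :> R.
  by case: n => [|n]; [rewrite ln0|rewrite ln_ge0// ler1n].
have quarter : 0 < 1 / 4 :> R by rewrite divr_gt0.
(* 1/4 stands for any exponent strictly between 0 and 1/2. *)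
apply: (@hausdorff_dim_level_set_slow _ (1 / 4)).
- by rewrite quarter/= ltr_pM2l// ltf_pV2 ?posrE// ltr_nat.
- by move=> n; rewrite mulr_ge0.
- move=> m n mn; case: m mn => [|m] mn; first by rewrite mul0r mulr_ge0.
  have n0 : (0 < n)%N by exact: leq_trans mn.
  by rewrite ler_pM// ?ler_nat// ler_ln ?posrE ?ltr0n// ler_nat.
- near=> n; have n1 : (1 < n)%N by near: n; exact: nbhs_infty_gt.
  by rewrite mulr_gt0 ?ltr0n ?ln_gt0 ?ltr1n// ltnW.
- near=> n; have n0 : 0 < n%:R :> R by rewrite ltr0n; near: n; exact: nbhs_infty_gt.
  apply: (@le_trans _ _ (n%:R `^ 2)).
    by rewrite powR_mulrn// expr2 ler_pM2l// ltW// ln_sublinear.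
  by near: n; exact: near_powR_le_stretched_exp.
- exact/cvg_superlinear/near_ln_superlinear.
- rewrite -[X in _ --> X](mulr1 1).
  under eq_fun do rewrite -mulf_div.
  apply: cvgM; last exact: cvg_ln_sqr_ratio.
  under eq_fun do
    rewrite -(powRr1 (ler0n _ (_.+1 ^ 2))) -(powRr1 (ler0n _ (_.+2 ^ 2))).
  exact: cvg_powR_sqr_ratio.
Unshelve. all: by end_near. Qed.

Lemma hausdorff_dim_level_set_powR a (beta : \bar R) : 1 < a -> (0 <= beta)%E ->
  hausdorff_dim (level_set (fun n => n%:R `^ a) beta) = 1%E.
Proof.
move=> a1; have a0 : 0 < a by rewrite (lt_trans ltr01).
have quarter : 0 < 1 / 4 :> R by rewrite divr_gt0.
apply: (@hausdorff_dim_level_set_slow _ (1 / 4)).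
- by rewrite quarter/= ltr_pM2l// ltf_pV2 ?posrE// ltr_nat.
- by move=> n; exact: powR_ge0.
- by move=> m n mn; rewrite ge0_ler_powR ?nnegrE ?(ltW a0)// ler_nat.
- near=> n; rewrite powR_gt0// ltr0n; near: n; exact: nbhs_infty_gt.
- exact: near_powR_le_stretched_exp.
- by apply: cvg_superlinear => A; exact: near_powR_superlinear.
- by apply: cvg_powR_sqr_ratio; rewrite ltW.
Unshelve. all: by end_near. Qed.

Lemma hausdorff_dim_level_set_stretched_exp gamma (beta : \bar R) :
  0 < gamma < 1 / 2 -> (0 <= beta)%E ->
  hausdorff_dim (level_set (stretched_exp gamma) beta) = 1%E.
Proof.
move=> gamma12; have /andP[gamma0 gamma2] := gamma12.
apply: (@hausdorff_dim_level_set_slow _ gamma) => //.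
- by move=> n; rewrite ltW// stretched_exp_gt0.
- exact: stretched_exp_le (ltW gamma0).
- by apply: nearW => n; exact: stretched_exp_gt0.
- by apply: nearW.
- by apply: cvg_superlinear => A; exact: near_stretched_exp_superlinear.
- by apply: cvg_stretched_exp_sqr_ratio; rewrite ltW.
Qed.

Lemma hausdorff_dim_level_set0_stretched_exp gamma : 0 < gamma ->
  hausdorff_dim (level_set (stretched_exp gamma) 0%E) = 1%E.
Proof.
move=> gamma0; apply: hausdorff_dim_level_set0 => [n|].
  by rewrite ltW// stretched_exp_gt0.
by apply: cvg_superlinear => A; exact: near_stretched_exp_superlinear.
Qed.

End slow_growth.

Theorem theorem1p3 (R : realType) :
  [/\
    (forall Psi : nat -> R,
       [\/ Psi = (fun n => n%:R * ln n%:R),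
           (exists2 a : R, 1 < a & Psi = (fun n => n%:R `^ a))
         | (exists2 gamma : R, 0 < gamma < 1 / 2 &
              Psi = (fun n => 2 `^ (n%:R `^ gamma)))] ->
       forall beta : \bar R, (0 <= beta)%E ->
         hausdorff_dim (level_set Psi beta) = 1%E),
    (forall gamma : R, 1 / 2 <= gamma < 1 ->
       let Psi := fun n : nat => 2 `^ (n%:R `^ gamma) in
       [/\ (forall beta : \bar R, (0 < beta < +oo)%E ->
              level_set Psi beta = set0),
           hausdorff_dim (level_set Psi 0%E) = 1%E
         & hausdorff_dim (level_set Psi +oo%E) = 1%E])
    & (forall gamma : R, 1 <= gamma ->
       let Psi := fun n : nat => 2 `^ (n%:R `^ gamma) in
       (forall beta : \bar R, (0 < beta)%E -> level_set Psi beta = set0) /\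
       hausdorff_dim (level_set Psi 0%E) = 1%E)].
Proof.
split.
- move=> Psi [->|[a a1 ->]|[gamma gamma12 ->]] beta beta0.
  + exact: hausdorff_dim_level_set_nlogn.
  + exact: hausdorff_dim_level_set_powR.
  + exact: hausdorff_dim_level_set_stretched_exp.
- move=> gamma gamma12 /=; have /andP[gamma1 gamma2] := gamma12.
  have gamma0 : 0 < gamma by apply: lt_le_trans gamma1; rewrite divr_gt0.
  split.
  + move=> [beta| |] //; rewrite ?lte_fin ?ltxx ?andbF// => /andP[beta0 _].
    exact: level_set_stretched_exp_mid_eq0.
  + exact: hausdorff_dim_level_set0_stretched_exp.
  + apply: (@hausdorff_dim_level_set_pinfty _ _ gamma); first by rewrite gamma0.
    by apply: nearW => n; rewrite powR_gt0/=.
- move=> gamma gamma1 /=; have gamma0 : 0 < gamma by apply: lt_le_trans gamma1.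
  split; last exact: hausdorff_dim_level_set0_stretched_exp.
  move=> [beta beta0| _|] //; last exact: level_set_stretched_exp_pinfty_eq0.
  exact: level_set_stretched_exp_pos_eq0.
Qed.
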